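(* Let $G$ be a profinite group and $M$ a rational $G$-Mackey functor. Let $K\leqslant H$ be open subgroups of $G$ and let $N\leqslant K$ be an open subgroup which is normal in $H$. Then restriction $R^H_K$ from $H$ to $K$ induces an isomorphism $$e^H_{N,K}\,M(H)\;\cong\; e^K_{N,K}\,M(K)^{N_H(K)}.$$
   Context: A rational $G$-Mackey functor $M$ is a $\mathbb{Q}$-module $M(H)$ for each open subgroup $H\leqslant G$ with $\mathbb{Q}$-linear maps $R^H_K\colon M(H)\to M(K)$ (restriction), $I^H_K\colon M(K)\to M(H)$ (induction), $C_g\colon M(H)\to M(gHg^{-1})$ (conjugation) for open $K\leqslant H$ and $g\in G$, such that: (1) $R^H_H=I^H_H=\mathrm{Id}$ and $C_h=\mathrm{Id}_{M(H)}$ for $h\in H$; (2) for open $L\leqslant K\leqslant H$ and $g,h\in G$: $I^H_L=I^H_KI^K_L$, $R^H_L=R^K_LR^H_K$, $C_{gh}=C_gC_h$; (3) $R^{gHg^{-1}}_{gKg^{-1}}C_g=C_gR^H_K$, $I^{gHg^{-1}}_{gKg^{-1}}C_g=C_gI^H_K$; (4) for open $K,L\leqslant H$: $R^H_KI^H_L=\sum_{x\in[K\backslash H/L]}I^K_{K\cap xLx^{-1}}C_xR^L_{L\cap x^{-1}Kx}$. $N_H(K)$ is the normaliser of $K$ in $H$; it acts on $M(K)$ by the conjugation maps, and $M(K)^{N_H(K)}$ denotes fixed points. $\mathcal{S}H$ is the space of closed subgroups of $H$, topologised as $\lim_N\mathcal{S}(H/N)$ over open normal subgroups $N$ of $H$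 (each $\mathcal{S}(H/N)$ finite discrete, projections $L\mapsto LN/N$), with $H$ acting by conjugation. $\mathbf{A}_{\mathbb{Q}}(H)$ is the rational Grothendieck ring of finite discrete sets with continuous $H$-action. It acts on $M(H)$ by $[H/K]\mapsto I^H_KR^H_K$ ($K\leqslant H$ open), and it is identified with the ring $C(\mathcal{S}H/H,\mathbb{Q})$ of continuous functions ($\mathbb{Q}$ discrete) by sending $[H/K]$ to $L\mapsto|(H/K)^L|$. For $N$ open normal in $H$ and $J$ an open subgroup of $H$ containing $N$, $e^H_{N,J}\in\mathbf{A}_{\mathbb{Q}}(H)$ is the idempotent given by the characteristic function of the image in $\mathcal{S}H/H$ of the open and closed set $O_H(N,J)=\{L\in\mathcal{S}H\mid NL=J\}$. *)

(* Defs.v *)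
From HB Require Import structures.
From mathcomp Require Import all_boot all_order all_algebra.
From mathcomp Require Import finmap generic_quotient.
From mathcomp Require Import mathcomp_extra boolp classical_sets functions.
From mathcomp Require Import cardinality topology.

Set Implicit Arguments.
Unset Strict Implicit.
Unset Printing Implicit Defensive.

Import GRing.Theory.

Local Open Scope classical_set_scope.
Local Open Scope group_scope.

HB.mixin Record isTopologicalGroup G of Topological G & Group G := {
  mulg_continuous : continuous (fun xy : G * G => xy.1 * xy.2);
  invg_continuous : continuous (fun x : G => x^-1)
}.

#[short(type="topologicalGroupType")]
HB.structure Definition TopologicalGroup :=
  {G of Topological G & Group G & isTopologicalGroup G}.

Definition profinite (G : topologicalGroupType) : Prop :=
  [/\ compact [set: G], hausdorff_space G & totally_disconnected [set: G]].

Identity Coercion set_to_pred : set >-> Funclass.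

Section Subgroups.
Variable G : topologicalGroupType.
Implicit Types (A B : set G) (g h : G).

Definition subgroup A : Prop :=
  A 1 /\ forall x y, A x -> A y -> A (x * y^-1).

Lemma subgroupV A x : subgroup A -> A x -> A x^-1.
Proof. by move=> [A1 AD] Ax; rewrite -[x^-1]mul1g; apply: AD. Qed.

Lemma subgroupM A x y : subgroup A -> A x -> A y -> A (x * y).
Proof.
by move=> sA Ax Ay; rewrite -[y]invgK; apply: sA.2 => //; apply: subgroupV.
Qed.

Record openSubgroup := OpenSubgroup {
  osg_set :> set G;
  osg_subgroup : subgroup osg_set;
  osg_open : open osg_set
}.

Lemma mulgl_continuous g : continuous (fun x : G => g * x).
Proof.
move=> x; apply: (@continuous_comp _ _ _ (fun x => (g, x)) (fun xy => xy.1 * xy.2)).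
  by apply: cvg_pair; [exact: cvg_cst|exact: cvg_id].
exact: mulg_continuous.
Qed.

Lemma mulgr_continuous g : continuous (fun x : G => x * g).
Proof.
move=> x; apply: (@continuous_comp _ _ _ (fun x => (x, g)) (fun xy => xy.1 * xy.2)).
  by apply: cvg_pair; [exact: cvg_id|exact: cvg_cst].
exact: mulg_continuous.
Qed.

Definition conj_set g A : set G := [set g * a * g^-1 | a in A].

Lemma conj_setE g A x : conj_set g A x = A (g^-1 * x * g).
Proof.
apply/propext; split=> [[a Aa <-]|Ax].
  by rewrite !mulgA mulVg mul1g mulgVK.
by exists (g^-1 * x * g) => //; rewrite !mulgA mulgV mul1g mulgK.
Qed.

Lemma conj_set_subgroup g A : subgroup A -> subgroup (conj_set g A).
Proof.
move=> sA; split; first by rewrite conj_setE mulg1 mulVg; apply: sA.1.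
move=> x y; rewrite !conj_setE => Ax Ay.
have -> : g^-1 * (x * y^-1) * g = (g^-1 * x * g) * (g^-1 * y * g)^-1.
  by rewrite !invgM invgK !mulgA mulgK.
exact: sA.2.
Qed.

Lemma conj_set_open g A : open A -> open (conj_set g A).
Proof.
move=> oA; have -> : conj_set g A = (fun x => (g^-1 * x) * g) @^-1` A.
  by apply/seteqP; split=> x /=; rewrite conj_setE.
apply: open_comp => // x _.
apply: (@continuous_comp _ _ _ (fun x => g^-1 * x) (fun x => x * g)).
  exact: mulgl_continuous.
exact: mulgr_continuous.
Qed.

Definition osg_conj g (H : openSubgroup) : openSubgroup :=
  OpenSubgroup (conj_set_subgroup g (osg_subgroup H))
               (conj_set_open g (@osg_open H)).

Lemma subgroupI A B : subgroup A -> subgroup B -> subgroup (A `&` B).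
Proof.
move=> sA sB; split; first by split; [exact: sA.1|exact: sB.1].
by move=> x y [Ax Bx] [Ay By]; split; [exact: sA.2|exact: sB.2].
Qed.

Definition osg_cap (H K : openSubgroup) : openSubgroup :=
  OpenSubgroup (subgroupI (osg_subgroup H) (osg_subgroup K))
               (openI (@osg_open H) (@osg_open K)).

Definition normaliser (H K : openSubgroup) : set G :=
  [set g | H g /\ conj_set g K = K].

Definition normal_in (H N : openSubgroup) : Prop :=
  N `<=` H /\ forall h, H h -> conj_set h N = N.

Definition double_coset_reps (K H L : openSubgroup) (xs : seq G) : Prop :=
  [/\ uniq xs, forall x, x \in xs -> H x
    & forall h, H h -> exists! x, x \in xs /\
        exists k l, [/\ K k, L l & h = k * x * l]].

Lemma cap_conj_sub (K L : openSubgroup) x :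
  osg_cap K (osg_conj x L) `<=` K.
Proof. by move=> y []. Qed.

Lemma conj_cap (K L : openSubgroup) x :
  osg_cap K (osg_conj x L) =
  conj_set x (osg_cap L (osg_conj x^-1 K)) :> set G.
Proof.
apply/seteqP; split => y; rewrite conj_setE /= /setI /=.
  by rewrite !conj_setE invgK !mulgA mulgV mul1g mulgK => -[].
by rewrite !conj_setE invgK !mulgA mulgV mul1g mulgK => -[].
Qed.

End Subgroups.

(* Dependent types make [C_g C_h] and [C_gh], or the two sides of the double
   coset formula, live in propositionally but not definitionally equal modules.
   Conjugation is therefore given as maps [M H -> M H'] for every [H'] with
   [H' = g H g^-1], and restriction and induction take the inclusion as an
   argument. *)
Record mackeyFunctor (G : topologicalGroupType) := MackeyFunctor {
  mky_val :> openSubgroup G -> lmodType rat;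
  mky_res : forall H K : openSubgroup G, K `<=` H ->
    {linear mky_val H -> mky_val K};
  mky_ind : forall H K : openSubgroup G, K `<=` H ->
    {linear mky_val K -> mky_val H};
  mky_conj : forall g (H H' : openSubgroup G), H' = conj_set g H :> set G ->
    {linear mky_val H -> mky_val H'};
  mky_res_id : forall (H : openSubgroup G) (s : H `<=` H) m, mky_res s m = m;
  mky_ind_id : forall (H : openSubgroup G) (s : H `<=` H) m, mky_ind s m = m;
  mky_conj_id : forall (H : openSubgroup G) h (e : H = conj_set h H :> set G) m,
    H h -> mky_conj e m = m;
  mky_ind_comp : forall H K L : openSubgroup G,
    forall (sKH : K `<=` H) (sLK : L `<=` K) (sLH : L `<=` H) m,
    mky_ind sLH m = mky_ind sKH (mky_ind sLK m);
  mky_res_comp : forall H K L : openSubgroup G,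
    forall (sKH : K `<=` H) (sLK : L `<=` K) (sLH : L `<=` H) m,
    mky_res sLH m = mky_res sLK (mky_res sKH m);
  mky_conj_comp : forall g h (H H' H'' : openSubgroup G)
    (e1 : H' = conj_set h H :> set G) (e2 : H'' = conj_set g H' :> set G)
    (e3 : H'' = conj_set (g * h) H :> set G) m,
    mky_conj e3 m = mky_conj e2 (mky_conj e1 m);
  mky_res_conj : forall g (H K H' K' : openSubgroup G)
    (s : K `<=` H) (s' : K' `<=` H')
    (eH : H' = conj_set g H :> set G) (eK : K' = conj_set g K :> set G) m,
    mky_res s' (mky_conj eH m) = mky_conj eK (mky_res s m);
  mky_ind_conj : forall g (H K H' K' : openSubgroup G)
    (s : K `<=` H) (s' : K' `<=` H')
    (eH : H' = conj_set g H :> set G) (eK : K' = conj_set g K :> set G) m,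
    mky_ind s' (mky_conj eK m) = mky_conj eH (mky_ind s m);
  mky_double_coset : forall (H K L : openSubgroup G)
    (sKH : K `<=` H) (sLH : L `<=` H) (xs : seq G),
    double_coset_reps K H L xs -> forall m : mky_val L,
    mky_res sKH (mky_ind sLH m) =
    (\sum_(x <- xs)
      mky_ind (@cap_conj_sub G K L x)
        (mky_conj (conj_cap K L x)
          (mky_res (@cap_conj_sub G L K (x^-1)%g) m)))%R
}.

Definition mky_fixed (G : topologicalGroupType) (M : mackeyFunctor G)
    (H K : openSubgroup G) : set (M K) :=
  [set m | forall g (e : K = conj_set g K :> set G),
     normaliser H K g -> mky_conj M e m = m].
Arguments mky_fixed {G} M H K.

Section FiniteSets.
Variables (G : topologicalGroupType) (H : openSubgroup G).

(* Only the values of [gs_act] on [H] are meaningful: the isomorphisms below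
   do not see the others. Since the carrier is finite and discrete, the last
   field is the continuity of the action map [H * X -> X]. The carrier is kept
   apart from its [Finite] structure so that it ranges over a universe small
   enough for [finGset] to be a [choiceType]. *)
Record finGset := FinGset {
  gs_car : Type;
  gs_fin : Finite gs_car;
  gs_act : G -> gs_car -> gs_car;
  gs_act1 : forall x, gs_act 1 x = x;
  gs_actM : forall g h x, H g -> H h -> gs_act (g * h) x = gs_act g (gs_act h x);
  gs_cont : forall x y, open [set g | H g /\ gs_act g x = y]
}.

Coercion gs_finType (X : finGset) : finType := Finite.Pack (gs_fin X).

HB.instance Definition _ := gen_eqMixin finGset.
HB.instance Definition _ := gen_choiceMixin finGset.

Definition gset_iso (X Y : finGset) : Prop :=
  exists f : X -> Y, bijective f /\
    forall g x, H g -> f (gs_act g x) = gs_act g (f x).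

Section Sum.
Variables X Y : finGset.

Definition sum_act g (s : X + Y) : X + Y :=
  match s with
  | inl x => inl (gs_act g x)
  | inr y => inr (gs_act g y)
  end.

Fact sum_act1 s : sum_act 1 s = s.
Proof. by case: s => s /=; rewrite gs_act1. Qed.

Fact sum_actM g h s : H g -> H h -> sum_act (g * h) s = sum_act g (sum_act h s).
Proof. by case: s => s Hg Hh /=; rewrite gs_actM. Qed.

Fact sum_cont s t : open [set g | H g /\ sum_act g s = t].
Proof.
case: s t => [x|y] [x'|y'] /=.
- rewrite [X in open X](_ : _ = [set g | H g /\ gs_act g x = x']).
    exact: gs_cont.
  by apply/seteqP; split => g /= [Hg]; [case|move=> ->].
- by rewrite [X in open X](_ : _ = set0) -?subset0 => [|g []//]; exact: open0.
- by rewrite [X in open X](_ : _ = set0) -?subset0 => [|g []//]; exact: open0.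
- rewrite [X in open X](_ : _ = [set g | H g /\ gs_act g y = y']).
    exact: gs_cont.
  by apply/seteqP; split => g /= [Hg]; [case|move=> ->].
Qed.

Definition gset_sum : finGset :=
  @FinGset (gs_car X + gs_car Y)%type (Finite.class (X + Y)%type) _
    sum_act1 sum_actM sum_cont.

Definition prod_act g (p : X * Y) : X * Y := (gs_act g p.1, gs_act g p.2).

Fact prod_act1 p : prod_act 1 p = p.
Proof. by case: p => x y; rewrite /prod_act /= !gs_act1. Qed.

Fact prod_actM g h p :
  H g -> H h -> prod_act (g * h) p = prod_act g (prod_act h p).
Proof. by move=> Hg Hh; rewrite /prod_act /= !gs_actM. Qed.

Fact prod_cont p q : open [set g | H g /\ prod_act g p = q].
Proof.
case: p q => [x y] [x' y'].
rewrite [X in open X](_ : _ = [set g | H g /\ gs_act g x = x'] `&`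
                              [set g | H g /\ gs_act g y = y']).
  by apply: openI; exact: gs_cont.
apply/seteqP; split => g /=; first by case=> Hg [].
by case=> -[Hg <-] [_ <-].
Qed.

Definition gset_prod : finGset :=
  @FinGset (gs_car X * gs_car Y)%type (Finite.class (X * Y)%type) _
    prod_act1 prod_actM prod_cont.

End Sum.

Fact unit_cont (x y : unit) : open [set g | H g /\ x = y].
Proof.
case: x y => -[]; rewrite [X in open X](_ : _ = H :> set G); first exact: osg_open.
by apply/seteqP; split => g // [].
Qed.

Definition gset_point : finGset :=
  @FinGset unit (Finite.class unit) (fun _ x => x) (fun _ => erefl) (fun _ _ _ _ _ => erefl)
    unit_cont.

(* The rational Grothendieck ring is presented as the Q-vector space on the
   finite H-sets modulo isomorphism and [X + Y] = [X] + [Y]; a list of pairs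
   (q, X) stands for the formal sum of the q [X]. *)
Definition fsum := seq (rat * finGset).
HB.instance Definition _ := Choice.on fsum.

Inductive fsum_eq : fsum -> fsum -> Prop :=
| feq_refl a : fsum_eq a a
| feq_sym a b : fsum_eq a b -> fsum_eq b a
| feq_trans b a c : fsum_eq a b -> fsum_eq b c -> fsum_eq a c
| feq_cat a a' b b' : fsum_eq a a' -> fsum_eq b b' -> fsum_eq (a ++ b) (a' ++ b')
| feq_catC a b : fsum_eq (a ++ b) (b ++ a)
| feq_coef0 X : fsum_eq [:: (0%R, X)] [::]
| feq_coefD p q X : fsum_eq [:: ((p + q)%R, X)] [:: (p, X); (q, X)]
| feq_iso q X Y : gset_iso X Y -> fsum_eq [:: (q, X)] [:: (q, Y)]
| feq_sum q X Y : fsum_eq [:: (q, gset_sum X Y)] [:: (q, X); (q, Y)].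

Definition fsum_eqb (a b : fsum) : bool := `[< fsum_eq a b >].

Fact fsum_eqb_refl : reflexive fsum_eqb.
Proof. by move=> a; apply/asboolP; exact: feq_refl. Qed.

Fact fsum_eqb_sym : symmetric fsum_eqb.
Proof. by move=> a b; apply/asboolP/asboolP; exact: feq_sym. Qed.

Fact fsum_eqb_trans : transitive fsum_eqb.
Proof.
by move=> b a c /asboolP ab /asboolP bc; apply/asboolP; exact: feq_trans ab bc.
Qed.

Canonical fsum_equiv := EquivRel fsum_eqb fsum_eqb_refl fsum_eqb_sym fsum_eqb_trans.

Definition burnside := {eq_quot fsum_equiv}%qT.

HB.instance Definition _ := Choice.on burnside.

Definition bpi (a : fsum) : burnside := (\pi_burnside a)%qT.

Lemma bpiP a b : bpi a = bpi b <-> fsum_eq a b.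
Proof.
rewrite /bpi; split; last by move=> e; apply/eqmodP/asboolP.
by move=> /eqmodP /asboolP.
Qed.

Lemma repr_bpi a : fsum_eq (repr (bpi a)) a.
Proof. by apply/bpiP; rewrite /bpi reprK. Qed.

Lemma bpi_ind (P : burnside -> Prop) : (forall a, P (bpi a)) -> forall x, P x.
Proof. by move=> Pa x; rewrite -[x]reprK; apply: Pa. Qed.

Lemma fsum_eq_map (f : rat -> rat) (F : finGset -> finGset) :
  (f 0 = 0)%R -> {morph f : p q / (p + q)%R} ->
  (forall X Y, gset_iso X Y -> gset_iso (F X) (F Y)) ->
  (forall X Y, gset_iso (F (gset_sum X Y)) (gset_sum (F X) (F Y))) ->
  forall a b, fsum_eq a b ->
    fsum_eq [seq (f t.1, F t.2) | t <- a] [seq (f t.1, F t.2) | t <- b].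
Proof.
move=> f0 fD Fiso Fsum a b; elim=> {a b} /=.
- by move=> a; exact: feq_refl.
- by move=> a b _; exact: feq_sym.
- by move=> b a c _ ab _; exact: feq_trans.
- by move=> a a' b b' _ h1 _ h2; rewrite !map_cat; exact: feq_cat.
- by move=> a b; rewrite !map_cat; exact: feq_catC.
- by move=> X; rewrite f0; exact: feq_coef0.
- by move=> p q X; rewrite fD; exact: feq_coefD.
- by move=> q X Y XY; apply: feq_iso; exact: Fiso.
- by move=> q X Y; apply: feq_trans (feq_sum _ _ _); apply: feq_iso; exact: Fsum.
Qed.

Lemma gset_iso_refl X : gset_iso X X.
Proof. by exists id; split => //; exists id. Qed.

Definition fsum_scale (c : rat) (a : fsum) : fsum := [seq ((c * t.1)%R, t.2) | t <- a].

Lemma fsum_scale_eq c a b : fsum_eq a b -> fsum_eq (fsum_scale c a) (fsum_scale c b).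
Proof.
apply: (@fsum_eq_map (fun q => c * q)%R id) => //.
- by rewrite mulr0.
- by move=> p q; exact: mulrDr.
- by move=> X Y; exact: gset_iso_refl.
Qed.

Definition badd (x y : burnside) : burnside := bpi (repr x ++ repr y).
Definition bscale (c : rat) (x : burnside) : burnside := bpi (fsum_scale c (repr x)).
Definition bopp (x : burnside) : burnside := bscale (- 1)%R x.

Lemma baddE a b : badd (bpi a) (bpi b) = bpi (a ++ b).
Proof. by apply/bpiP/feq_cat; exact: repr_bpi. Qed.

Lemma bscaleE c a : bscale c (bpi a) = bpi (fsum_scale c a).
Proof. by apply/bpiP/fsum_scale_eq; exact: repr_bpi. Qed.

Fact baddA : associative badd.
Proof.
by elim/bpi_ind=> a; elim/bpi_ind=> b; elim/bpi_ind=> c; rewrite !baddE catA.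
Qed.

Fact baddC : commutative badd.
Proof.
elim/bpi_ind=> a; elim/bpi_ind=> b; rewrite !baddE.
by apply/bpiP; exact: feq_catC.
Qed.

Fact badd0 : left_id (bpi [::]) badd.
Proof. by elim/bpi_ind=> a; rewrite baddE. Qed.

Lemma bscale1 : left_id 1%R bscale.
Proof.
elim/bpi_ind=> a; rewrite bscaleE; congr bpi.
by elim: a => //= -[q X] a /= ->; rewrite mul1r.
Qed.

Lemma bscale0 x : bscale 0%R x = bpi [::].
Proof.
elim/bpi_ind: x => a; rewrite bscaleE; apply/bpiP.
elim: a => [|[q X] a IH] /=; first exact: feq_refl.
rewrite mul0r -[[::]]/([::] ++ [::]) -cat1s; apply: feq_cat => //.
exact: feq_coef0.
Qed.

Lemma bscaleDl x : {morph bscale^~ x : c d / (c + d)%R >-> badd c d}.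
Proof.
move=> c d; elim/bpi_ind: x => a; rewrite !bscaleE baddE; apply/bpiP.
elim: a => [|[q X] a IH] /=; first exact: feq_refl.
rewrite mulrDl -cat1s.
apply: feq_trans (feq_cat (feq_coefD _ _ _) IH) _ => /=.
rewrite -[X in fsum_eq X]cat1s -[X in fsum_eq _ X]cat1s.
apply: feq_cat; first exact: feq_refl.
rewrite -cat1s -[X in fsum_eq _ (_ ++ X)]cat1s !catA.
by apply: feq_cat; [exact: feq_catC|exact: feq_refl].
Qed.

Fact baddN : left_inverse (bpi [::]) bopp badd.
Proof.
move=> x; rewrite /bopp -{2}[x]bscale1 -bscaleDl addNr; exact: bscale0.
Qed.

HB.instance Definition _ := GRing.isZmodule.Build burnside baddA baddC badd0 baddN.

Fact bscaleA c d x : bscale c (bscale d x) = bscale (c * d)%R x.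
Proof.
elim/bpi_ind: x => a; rewrite !bscaleE /fsum_scale -map_comp.
by congr bpi; apply: eq_map => t /=; rewrite mulrA.
Qed.

Fact bscaleDr : right_distributive bscale +%R.
Proof.
move=> c; elim/bpi_ind=> a; elim/bpi_ind=> b.
by rewrite -[(_ + _)%R]/(badd _ _) baddE !bscaleE -[RHS]/(badd _ _) baddE /fsum_scale map_cat.
Qed.

HB.instance Definition _ := GRing.Zmodule_isLmodule.Build rat burnside
  bscaleA bscale1 bscaleDr bscaleDl.

Definition fsum_mul (a b : fsum) : fsum :=
  [seq ((s.1 * t.1)%R, gset_prod s.2 t.2) | s <- a, t <- b].

Definition bone : burnside := bpi [:: (1%R, gset_point)].
Definition bmul (x y : burnside) : burnside := bpi (fsum_mul (repr x) (repr y)).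

Lemma gset_iso_prod X X' Y Y' : gset_iso X X' -> gset_iso Y Y' ->
  gset_iso (gset_prod X Y) (gset_prod X' Y').
Proof.
move=> [f [[f' fK f'K] fE]] [g [[g' gK g'K] gE]].
exists (fun p => (f p.1, g p.2)); split.
  exists (fun p : X' * Y' => (f' p.1, g' p.2)) => -[x y] /=.
    by rewrite fK gK.
  by rewrite f'K g'K.
by move=> h [x y] Hh; rewrite /= /prod_act /= fE // gE.
Qed.

Lemma gset_prodC X Y : gset_iso (gset_prod X Y) (gset_prod Y X).
Proof.
exists (fun p => (p.2, p.1)); split => //.
by exists (fun p : Y * X => (p.2, p.1)) => -[].
Qed.

Lemma gset_prodA X Y Z :
  gset_iso (gset_prod X (gset_prod Y Z)) (gset_prod (gset_prod X Y) Z).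
Proof.
exists (fun p => ((p.1, p.2.1), p.2.2)); split => //.
by exists (fun p : (X * Y) * Z => (p.1.1, (p.1.2, p.2))) => [[? []]|[[]]].
Qed.

Lemma gset_prod1 X : gset_iso (gset_prod gset_point X) X.
Proof.
by exists snd; split => //; exists (fun x => (tt, x)) => // -[[]].
Qed.

Lemma gset_prodDr X Y Z :
  gset_iso (gset_prod X (gset_sum Y Z)) (gset_sum (gset_prod X Y) (gset_prod X Z)).
Proof.
exists (fun p => match p.2 with inl y => inl (p.1, y) | inr z => inr (p.1, z) end).
split; last by move=> g [x [y|z]].
exists (fun s : (X * Y) + (X * Z) =>
  match s with inl p => (p.1, inl p.2) | inr p => (p.1, inr p.2) end).
  by move=> [x [y|z]].
by move=> [[x y]|[x z]].
Qed.

Lemma fsum_mul_eqr a b b' : fsum_eq b b' -> fsum_eq (fsum_mul a b) (fsum_mul a b').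
Proof.
move=> bb'; elim: a => [|[q X] a IH] /=; first exact: feq_refl.
rewrite /fsum_mul !allpairs_cons; apply: feq_cat => //=.
apply: (@fsum_eq_map (fun p => q * p)%R (gset_prod X)) => //.
- by rewrite mulr0.
- by move=> p p'; exact: mulrDr.
- by move=> Y Y'; apply: gset_iso_prod; exact: gset_iso_refl.
- exact: gset_prodDr.
Qed.

Lemma fsum_mul0 a : fsum_mul a [::] = [::].
Proof. by elim: a. Qed.

Lemma feq_catCA a b c : fsum_eq (a ++ (b ++ c)) (b ++ (a ++ c)).
Proof.
by rewrite !catA; apply: feq_cat; [exact: feq_catC|exact: feq_refl].
Qed.

Lemma feq_cons t a b : fsum_eq a b -> fsum_eq (t :: a) (t :: b).
Proof. by move=> ab; rewrite -cat1s -[t :: b]cat1s; exact: feq_cat (feq_refl _) ab. Qed.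

Lemma fsum_mul_consr a t b : fsum_eq (fsum_mul a (t :: b))
  ([seq ((s.1 * t.1)%R, gset_prod s.2 t.2) | s <- a] ++ fsum_mul a b).
Proof.
elim: a => [|s a IH]; first exact: feq_refl.
rewrite /fsum_mul !allpairs_cons -!/(fsum_mul _ _) /=; apply: feq_cons.
by apply: feq_trans (feq_cat (feq_refl _) IH) _; exact: feq_catCA.
Qed.

Lemma fsum_mulC a b : fsum_eq (fsum_mul a b) (fsum_mul b a).
Proof.
elim: b => [|t b IH]; first by rewrite fsum_mul0; exact: feq_refl.
apply: feq_trans (fsum_mul_consr _ _ _) _.
rewrite [X in fsum_eq _ X]/fsum_mul allpairs_cons -/(fsum_mul _ _).
apply: feq_cat => // {IH b}; elim: a => [|s a IH] /=; first exact: feq_refl.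
rewrite -cat1s -[X in fsum_eq _ X]cat1s; apply: feq_cat => //.
by rewrite mulrC; apply: feq_iso; exact: gset_prodC.
Qed.

Lemma bmulE a b : bmul (bpi a) (bpi b) = bpi (fsum_mul a b).
Proof.
apply/bpiP/(feq_trans (fsum_mul_eqr _ (repr_bpi b))).
apply: feq_trans (fsum_mulC _ _) _.
by apply: feq_trans (fsum_mul_eqr _ (repr_bpi a)) _; exact: fsum_mulC.
Qed.

Fact bmulC : commutative bmul.
Proof.
by elim/bpi_ind=> a; elim/bpi_ind=> b; rewrite !bmulE; apply/bpiP/fsum_mulC.
Qed.

Fact bmulDl : left_distributive bmul +%R.
Proof.
elim/bpi_ind=> a; elim/bpi_ind=> b; elim/bpi_ind=> c.
rewrite -[(_ + _)%R]/(badd _ _) baddE !bmulE -[RHS]/(badd _ _) baddE.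
by congr bpi; exact: allpairs_cat.
Qed.

Lemma bpi_cons t a : bpi (t :: a) = (bpi [:: t] + bpi a)%R.
Proof. by rewrite -[RHS]/(badd _ _) baddE. Qed.

Fact bmulA : associative bmul.
Proof.
have bmulDr : right_distributive bmul +%R.
  by move=> x y z; rewrite bmulC bmulDl ![bmul _ x]bmulC.
have bmul0 x : bmul x (bpi [::]) = bpi [::].
  by elim/bpi_ind: x => a; rewrite bmulE fsum_mul0.
have bmul0l x : bmul (bpi [::]) x = bpi [::] by rewrite bmulC.
elim/bpi_ind=> a; elim/bpi_ind=> b; elim/bpi_ind=> c.
elim: a => [|s a IHa]; first by rewrite !bmul0l.
rewrite bpi_cons !bmulDl IHa; congr (_ + _)%R => {IHa a}.
elim: b => [|t b IHb]; first by rewrite !(bmul0l, bmul0).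
rewrite [bpi (t :: b)]bpi_cons !(bmulDl, bmulDr) IHb; congr (_ + _)%R => {IHb b}.
elim: c => [|u c IHc]; first by rewrite !bmul0.
rewrite [bpi (u :: c)]bpi_cons !bmulDr IHc; congr (_ + _)%R => {IHc c}.
rewrite !bmulE /fsum_mul /= mulrA; apply/bpiP.
by apply: feq_iso; exact: gset_prodA.
Qed.

Fact bmul1 : left_id bone bmul.
Proof.
have bmulDr : right_distributive bmul +%R.
  by move=> x y z; rewrite bmulC bmulDl ![bmul _ x]bmulC.
elim/bpi_ind=> a; rewrite /bone.
elim: a => [|[q X] a IH]; first by rewrite bmulE.
rewrite bpi_cons bmulDr IH; congr (_ + _)%R; rewrite bmulE /fsum_mul /= mul1r.
by apply/bpiP/feq_iso; exact: gset_prod1.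
Qed.

HB.instance Definition _ := GRing.Zmodule_isComPzRing.Build burnside
  bmulA bmulC bmul1 bmulDl.

Definition bclass (X : finGset) : burnside := bpi [:: (1%R, X)].

Section Lift.
Variables (V : lmodType rat) (phi : finGset -> V).
Hypothesis phi_iso : forall X Y, gset_iso X Y -> phi X = phi Y.
Hypothesis phi_sum : forall X Y, phi (gset_sum X Y) = (phi X + phi Y)%R.

Definition burnside_lift (x : burnside) : V :=
  (\sum_(t <- repr x) t.1 *: phi t.2)%R.

Lemma burnside_liftE a : burnside_lift (bpi a) = (\sum_(t <- a) t.1 *: phi t.2)%R.
Proof.
suff sumE : forall a b, fsum_eq a b ->
  (\sum_(t <- a) t.1 *: phi t.2 = \sum_(t <- b) t.1 *: phi t.2)%R.
  exact: sumE (repr_bpi a).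
move=> {}a b; elim=> {a b} //.
- by move=> b a c _ ab _ bc; rewrite ab bc.
- by move=> a a' b b' _ ea _ eb; rewrite !big_cat /= ea eb.
- by move=> a b; rewrite !big_cat /= addrC.
- by move=> X; rewrite big_seq1 big_nil scale0r.
- by move=> p q X; rewrite !(big_cons, big_nil) /= !addr0 scalerDl.
- by move=> q X Y XY; rewrite !(big_cons, big_nil) /= (phi_iso XY).
- by move=> q X Y; rewrite !(big_cons, big_nil) /= !addr0 phi_sum scalerDr.
Qed.

Lemma burnside_lift_class X : burnside_lift (bclass X) = phi X.
Proof. by rewrite burnside_liftE big_seq1 scale1r. Qed.

Lemma burnside_lift_linear : linear burnside_lift.
Proof.
move=> c x y; elim/bpi_ind: x => a; elim/bpi_ind: y => b.
rewrite -[(c *: _)%R]/(bscale c _) bscaleE -[(_ + _)%R in LHS]/(badd _ _) baddE.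
rewrite !burnside_liftE big_cat big_map scaler_sumr; congr (_ + _)%R.
by apply: eq_bigr => t _; rewrite scalerA.
Qed.

End Lift.

Definition gset_mark (L : set G) (X : finGset) : rat^o :=
  (#|[pred x : X | `[< forall l, L l -> gs_act l x = x >]]|%:R)%R.

Definition mark (L : set G) : burnside -> rat := burnside_lift (gset_mark L).

Lemma gset_mark_iso (L : set G) X Y :
  L `<=` H -> gset_iso X Y -> gset_mark L X = gset_mark L Y.
Proof.
move=> LH [f [fbij fE]]; rewrite /gset_mark; congr (_%:R)%R.
rewrite -!sum1_card (reindex f) /=; last exact: onW_bij.
apply: eq_bigl => x; rewrite !inE; apply/asboolP/asboolP => fixx l Ll.
  by rewrite -fE ?fixx//; exact: LH.
by apply: (bij_inj fbij); rewrite fE ?fixx//; exact: LH.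
Qed.

Lemma gset_mark_sum (L : set G) X Y :
  gset_mark L (gset_sum X Y) = (gset_mark L X + gset_mark L Y)%R.
Proof.
rewrite /gset_mark -natrD; congr (_%:R)%R; rewrite -!sum1_card.
apply: etrans (@big_sumType _ _ addn X Y _ _) _ => /=.
congr (_ + _)%N; apply: eq_bigl => x; rewrite !inE;
  by apply/asboolP/asboolP => fixx l /fixx //=; [case|move=> ->].
Qed.

Lemma mark_class (L : set G) X : L `<=` H ->
  mark L (bclass X) = (#|[pred x : X | `[< forall l, L l -> gs_act l x = x >]]|%:R)%R.
Proof.
move=> LH; rewrite /mark burnside_lift_class // => [X' Y|X' Y].
  exact: gset_mark_iso.
exact: gset_mark_sum.
Qed.

Record closedSubgroup := ClosedSubgroup {
  csg_set :> set G;
  csg_subgroup : subgroup csg_set;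
  csg_closed : closed csg_set;
  csg_sub : csg_set `<=` H
}.

Definition NJ_set (N J : openSubgroup G) : set closedSubgroup :=
  [set L : closedSubgroup | [set n * l | n in N & l in L] = J].

(* The preimage in the space of closed subgroups of the image of
   [NJ_set N J] in the orbit space. *)
Definition NJ_saturation (N J : openSubgroup G) : set closedSubgroup :=
  [set L : closedSubgroup | exists L' : closedSubgroup,
     NJ_set N J L' /\ exists2 h, H h & L' = conj_set h L :> set G].

(* An element of the Burnside ring is determined by its marks, and every
   continuous conjugation-invariant function is the function of marks of some
   element; hence [burnside_idem N J] is the only element of the set below. *)
Definition burnside_idem (N J : openSubgroup G) : burnside :=
  xget 0%R [set a : burnside | forall L : closedSubgroup,
    mark L a = ((L \in NJ_saturation N J)%:R)%R].

Section Stabilisers.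
Variable X : finGset.

Lemma gs_act_inv g (x : X) : H g -> gs_act g^-1 (gs_act g x) = x.
Proof.
move=> Hg; rewrite -gs_actM ?mulVg ?gs_act1//.
exact: subgroupV (osg_subgroup H) Hg.
Qed.

Definition stab_set (x : X) : set G := [set g | H g /\ gs_act g x = x].

Fact stab_subgroup x : subgroup (stab_set x).
Proof.
split; first by split; [exact: (osg_subgroup H).1|exact: gs_act1].
move=> g h [Hg gx] [Hh hx]; split; first exact: (osg_subgroup H).2.
have Hh' := subgroupV (osg_subgroup H) Hh.
by rewrite gs_actM // -{1}hx gs_act_inv.
Qed.

Definition stab (x : X) : openSubgroup G :=
  OpenSubgroup (stab_subgroup x) (gs_cont x x).

Lemma stab_sub x : stab x `<=` H. Proof. by move=> g []. Qed.

Definition gorbit (x : X) : {pred X} :=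
  [pred y : X | `[< exists2 g, H g & gs_act g x = y >]].

End Stabilisers.

Section Cosets.
Variable K : openSubgroup G.

Definition lcoset (h : G) : set G := [set h * k | k in K].

Lemma lcosetE h x : lcoset h x = K (h^-1 * x).
Proof.
apply/propext; split=> [[k Kk <-]|Kx]; first by rewrite mulKg.
by exists (h^-1 * x) => //; rewrite mulVKg.
Qed.

Lemma lcoset_eq g h : lcoset g = lcoset h <-> K (g^-1 * h).
Proof.
have sK := osg_subgroup K; split=> [e|Kgh].
  by rewrite -lcosetE e lcosetE mulVg; exact: sK.1.
apply/seteqP; split => x; rewrite !lcosetE => Kx.
  have -> : h^-1 * x = (g^-1 * h)^-1 * (g^-1 * x).
    by rewrite invgM invgK !mulgA mulgK.
  by apply: subgroupM => //; exact: subgroupV.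
have -> : g^-1 * x = (g^-1 * h) * (h^-1 * x) by rewrite !mulgA mulgK.
exact: subgroupM.
Qed.

Definition lcosets_set : set (set G) := lcoset @` H.

(* [fset_set] is empty on an infinite set, which does not occur in a profinite
   group: see [finite_lcosets]. *)
Definition coset_fset := fset_set lcosets_set.

(* A sigma type rather than the sort of [coset_fset], which lives in too large
   a universe to be the carrier of a [finGset]. *)
Definition coset_car := {C : G -> Prop | (C : set G) \in coset_fset}.

Definition to_fset (C : coset_car) : coset_fset := FSetSub (svalP C).
Definition of_fset (C : coset_fset) : coset_car := exist _ (fsval C) (fsvalP C).

Fact to_fsetK : cancel to_fset of_fset.
Proof. by case=> C inC; congr exist; exact: eq_irrelevance. Qed.

HB.instance Definition _ := Finite.copy coset_car (can_type to_fsetK).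
HB.instance Definition _ :=
  SubType.copy coset_car {C : G -> Prop | (C : set G) \in coset_fset}.

Definition coset_act (g : G) (C : coset_car) : coset_car :=
  insubd C [set g * y | y in val C].

Lemma coset_carP (C : coset_car) : exists2 h, H h & val C = lcoset h.
Proof.
have fin : finite_set lcosets_set.
  apply: contrapT => infin; case: C => C; rewrite /coset_fset /fset_set.
  by case: pselect.
by have := svalP C; rewrite in_fset_set // inE => -[h Hh e]; exists h.
Qed.

Lemma coset_mem (C : coset_car) h : H h -> lcoset h \in coset_fset.
Proof.
move=> Hh; have fin : finite_set lcosets_set.
  apply: contrapT => infin; case: C => C; rewrite /coset_fset /fset_set.
  by case: pselect.
by rewrite in_fset_set // inE; exists h.
Qed.

Lemma coset_actE g h (C : coset_car) : H g -> H h -> val C = lcoset h ->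
  val (coset_act g C) = lcoset (g * h).
Proof.
move=> Hg Hh eC; rewrite val_insubd.
have -> : [set g * y | y in val C] = lcoset (g * h).
  rewrite eC; apply/seteqP; split=> [x [_ [k Kk <-] <-]|x [k Kk <-]].
    by exists k => //; rewrite mulgA.
  by exists (h * k); [exists k|rewrite mulgA].
by rewrite (coset_mem C) //; exact: subgroupM (osg_subgroup H) _ _.
Qed.

Fact coset_act1 C : coset_act 1 C = C.
Proof.
have [h Hh eC] := coset_carP C; apply/val_inj.
by rewrite (coset_actE (osg_subgroup H).1 Hh eC) mul1g.
Qed.

Fact coset_actM g h C :
  H g -> H h -> coset_act (g * h) C = coset_act g (coset_act h C).
Proof.
move=> Hg Hh; have [x Hx eC] := coset_carP C; apply/val_inj.
have HM := subgroupM (osg_subgroup H).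
rewrite (coset_actE (HM _ _ Hg Hh) Hx eC).
by rewrite (coset_actE Hg (HM _ _ Hh Hx) (coset_actE Hh Hx eC)) mulgA.
Qed.

Fact coset_cont (C D : coset_car) : open [set g | H g /\ coset_act g C = D].
Proof.
have [h Hh eC] := coset_carP C.
rewrite openE => g [Hg gC]; rewrite /interior nbhsE.
exists [set x | (osg_cap H (osg_conj h K)) (g^-1 * x)].
  split; last first.
    rewrite /= mulVg; exact: (osg_subgroup (osg_cap H (osg_conj h K))).1.
  apply: open_comp; last exact: osg_open.
  by move=> x _; exact: mulgl_continuous.
move=> x /= [Hx]; rewrite conj_setE => Kx.
have Hx' : H x by rewrite -[x](mulVKg g); exact: subgroupM (osg_subgroup H) _ _.
split=> //; rewrite -gC; apply/val_inj; rewrite !(coset_actE _ Hh) //.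
apply/lcoset_eq; rewrite invgM.
have -> : h^-1 * x^-1 * (g * h) = (h^-1 * (g^-1 * x) * h)^-1.
  by rewrite !invgM !invgK !mulgA.
exact: subgroupV (osg_subgroup K) _.
Qed.

Definition coset_gset : finGset :=
  @FinGset coset_car (Finite.class coset_car) _ coset_act1 coset_actM coset_cont.

Lemma finite_lcosets : profinite G -> finite_set lcosets_set.
Proof.
case=> cG _ _.
pose pG : ptopologicalType := HB.pack (TopologicalGroup.sort G) (isPointed.Build G 1).
have /(_ G setT lcoset) [] : @cover_compact pG setT by rewrite -compact_cover.
- move=> g _; have -> : lcoset g = (fun x => g^-1 * x) @^-1` K.
    by apply/seteqP; split => x /=; rewrite lcosetE.
  apply: open_comp; last exact: osg_open.
  by move=> x _; exact: mulgl_continuous.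
- move=> g _; exists g => //; rewrite lcosetE mulVg.
  exact: (osg_subgroup K).1.
move=> D _ cov; apply: (@sub_finite_set _ _ (lcoset @` [set` D])); last first.
  by apply: finite_image; exact: finite_fset.
move=> _ [h Hh <-]; have [g Dg] := cov h I.
by rewrite lcosetE => /lcoset_eq <-; exists g.
Qed.

End Cosets.

End FiniteSets.

Section Action.
Variables (G : topologicalGroupType) (M : mackeyFunctor G) (H : openSubgroup G).

(* The sum of [I R] over a set of representatives of the orbits of [X], written
   without choosing representatives: see [burnside_act_coset]. *)
Definition gset_act (m : M H) (X : finGset H) : M H :=
  (\sum_(x : X) (#|gorbit x|%:R)^-1 *:
     mky_ind M (@stab_sub _ _ X x) (mky_res M (@stab_sub _ _ X x) m))%R.

Definition burnside_act (a : burnside H) (m : M H) : M H :=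
  burnside_lift (gset_act m) a.

Lemma osg_inj (K L : openSubgroup G) : K = L :> set G -> K = L.
Proof.
case: K L => [K sK oK] [L sL oL] /= e; subst L.
by rewrite (Prop_irrelevance sK sL) (Prop_irrelevance oK oL).
Qed.

Lemma ind_res_eq (K L : openSubgroup G) (sK : K `<=` H) (sL : L `<=` H) m :
  K = L :> set G -> mky_ind M sK (mky_res M sK m) = mky_ind M sL (mky_res M sL m).
Proof. by move=> /osg_inj e; subst L; rewrite (Prop_irrelevance sK sL). Qed.

Lemma gset_act_iso m X Y : gset_iso X Y -> gset_act m X = gset_act m Y.
Proof.
move=> [f [fbij fE]]; rewrite /gset_act [RHS](reindex f) /=; last exact: onW_bij.
apply: eq_bigr => x _; congr (_ *: _)%R; last first.
  apply: ind_res_eq; apply/seteqP; split=> g /= [Hg e]; split=> //.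
    by rewrite -fE // e.
  by apply: (bij_inj fbij); rewrite fE.
congr (_%:R^-1)%R; rewrite -!sum1_card [RHS](reindex f) /=; last exact: onW_bij.
apply: eq_bigl => y; rewrite !inE.
by apply/asboolP/asboolP => -[g Hg e]; exists g => //;
  [rewrite -fE // e|apply: (bij_inj fbij); rewrite fE].
Qed.

Lemma gset_act_sum m X Y :
  gset_act m (gset_sum X Y) = (gset_act m X + gset_act m Y)%R.
Proof.
apply: etrans (@big_sumType _ _ +%R X Y _ _) _ => /=.
congr (_ + _)%R; apply: eq_bigr => x _; congr (_ *: _)%R.
- congr (_%:R^-1)%R; rewrite -!sum1_card.
  apply: etrans (@big_sumType _ _ addn X Y _ _) _ => /=.
  rewrite [X in (_ + X)%N]big_pred0 ?addn0 => [|y]; last first.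
    by rewrite !inE; apply/asboolP => -[].
  apply: eq_bigl => y; rewrite !inE.
  by apply/asboolP/asboolP => -[g Hg e]; exists g => //; [case: e|rewrite /= e].
- apply: ind_res_eq; apply/seteqP; split=> g /= [Hg e]; split=> //.
    by case: e.
  exact: (congr1 inl e).
- congr (_%:R^-1)%R; rewrite -!sum1_card.
  apply: etrans (@big_sumType _ _ addn X Y _ _) _ => /=.
  rewrite big_pred0 ?add0n => [|y]; last first.
    by rewrite !inE; apply/asboolP => -[].
  apply: eq_bigl => y; rewrite !inE.
  by apply/asboolP/asboolP => -[g Hg e]; exists g => //; [case: e|rewrite /= e].
- apply: ind_res_eq; apply/seteqP; split=> g /= [Hg e]; split=> //.
    by case: e.
  exact: (congr1 inr e).
Qed.

Lemma burnside_act_class X m : burnside_act (bclass X) m = gset_act m X.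
Proof.
by apply: burnside_lift_class; [exact: gset_act_iso|exact: gset_act_sum].
Qed.

Lemma burnside_act_linear m : linear (burnside_act^~ m).
Proof.
by apply: burnside_lift_linear; [exact: gset_act_iso|exact: gset_act_sum].
Qed.

Lemma burnside_act_coset (K : openSubgroup G) (sKH : K `<=` H) m :
  profinite G ->
  burnside_act (bclass (coset_gset H K)) m = mky_ind M sKH (mky_res M sKH m).
Proof.
move=> pG; have fin := finite_lcosets H K pG.
rewrite burnside_act_class /gset_act.
have H1 : H 1 by exact: (osg_subgroup H).1.
have sH := osg_subgroup H.
have mem1 : lcoset K 1 \in coset_fset H K by rewrite in_fset_set // inE; exists 1.
pose x0 : coset_gset H K :=
  exist (fun C : G -> Prop => (C : set G) \in coset_fset H K) _ mem1.
have orbE (x : coset_gset H K) : #|gorbit x| = #|coset_gset H K|.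
  apply: eq_card => y; rewrite !inE; apply/asboolP.
  have [h Hh ex] := coset_carP x; have [g Hg ey] := coset_carP y.
  have Hg' : H (g * h^-1) by apply: sH.2.
  exists (g * h^-1) => //; apply/val_inj.
  by rewrite [LHS](coset_actE Hg' Hh ex) ey mulgVK.
rewrite (eq_bigr (fun=> (#|coset_gset H K|%:R)^-1 *:
  mky_ind M sKH (mky_res M sKH m))%R) => [|x _].
  rewrite sumr_const -scaler_nat scalerA divff ?scale1r //.
  by rewrite Num.Theory.pnatr_eq0 -lt0n; apply/card_gt0P; exists x0.
rewrite orbE; congr (_ *: _)%R.
have [h Hh ex] := coset_carP x.
have eK : stab x = conj_set h K :> set G.
  apply/seteqP; split=> g.
    move=> [Hg /(congr1 val)]; rewrite [LHS](coset_actE Hg Hh ex) ex conj_setE.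
    by move=> /esym /lcoset_eq; rewrite mulgA.
  move=> gK; have Hg : H g.
    case: gK => k /sKH Hk <-; apply: subgroupM => //; last exact: subgroupV.
    exact: subgroupM.
  split=> //; apply/val_inj; rewrite [LHS](coset_actE Hg Hh ex) ex.
  by apply/esym/lcoset_eq; move: gK; rewrite conj_setE mulgA.
have eH : H = conj_set h H :> set G.
  apply/seteqP; split=> g; rewrite conj_setE => Hg.
    by apply: subgroupM => //; apply: subgroupM => //; exact: subgroupV.
  have -> : g = h * (h^-1 * g * h) * h^-1 by rewrite !mulgA mulgV mul1g mulgK.
  by apply: sH.2 => //; exact: subgroupM.
rewrite -{1}[m](mky_conj_id eH) // (mky_res_conj sKH _ eH eK).
by rewrite (mky_ind_conj sKH _ eH eK) mky_conj_id.
Qed.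

End Action.

(* Main.v *)
Require Import Defs.
From HB Require Import structures.
From mathcomp Require Import all_boot all_order all_algebra.
From mathcomp Require Import finmap.
From mathcomp Require Import boolp classical_sets functions cardinality topology.

(** Write e for the idempotent of (N, K) in the Burnside ring of H and e' for
    the one in the Burnside ring of K.  The theorem is deduced from a few facts
    on the action of Burnside rings on a Mackey functor.

    - Restriction turns the action of a in A(H) on M(H) into the action of the
      restriction of a on M(K) ([burnside_act_res]); this is the double coset
      formula.
    - The action is multiplicative ([burnside_actM]): acting by Y and then by X
      is acting by X * Y, since the orbits of X * Y above the orbit of x are the
      orbits of Y under the stabiliser of x.
    - The action of an element depends only on its marks ([burnside_act_eq]),
      because the table of marks is triangular for inclusion.

    The idempotent e exists: the marks of [H/J] tell which L are
    subconjugate to J, so interpolating polynomials in the classes [H/J], for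
    N <= J <= K, cut out the L that are subconjugate to K but to no smaller J
    ([burnside_idemP]).

    An L <= K with N L conjugate to K in H satisfies N L = K, as conjugates of
    K have the same index; hence e restricts to an element with the marks of e',
    and R (e m) = e' (R m) ([res_burnside_idem]).  Since restrictions from H are
    fixed by the normaliser, R maps the left-hand side into the right-hand side.

    Injectivity: if y = e y and R y = 0, then [H/K] y = I R y = 0; but e
    is supported on the L with nonzero mark at [H/K], and so y = 0
    ([res_burnside_idem_inj]).

    Surjectivity: let v = e' n with n fixed by the normaliser.  Then v is fixed
    too ([idem_act_fixed]) and restricts to 0 on every J with N <= J < K, as e'
    has no support there ([res_idem_proper]).  So in the double coset formula
    for R I v the double cosets outside the normaliser contribute 0 and those
    inside contribute v: R I v = w v with w > 0 ([res_ind_fixed]).  Hence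
    v = e' v = e' (R (I v / w)) = R (e (I v / w)). *)

Set Implicit Arguments.
Unset Strict Implicit.
Unset Printing Implicit Defensive.

Import GRing.Theory.

Local Open Scope classical_set_scope.

(** * Orbits and stabilisers of finite H-sets *)
Section Orbits.
Local Open Scope group_scope.
Variables (G : topologicalGroupType) (H : openSubgroup G).

Lemma osg1 : H 1. Proof. exact: (osg_subgroup H).1. Qed.

Lemma osgM x y : H x -> H y -> H (x * y).
Proof. exact: subgroupM (osg_subgroup H). Qed.

Lemma osgV x : H x -> H x^-1.
Proof. exact: subgroupV (osg_subgroup H). Qed.

Lemma conj_set_id h : H h -> H = conj_set h H :> set G.
Proof.
move=> Hh; apply/seteqP; split=> g; rewrite conj_setE => Hg.
  by apply: osgM => //; apply: osgM => //; exact: osgV.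
have -> : g = h * (h^-1 * g * h) * h^-1 by rewrite !mulgA mulgV mul1g mulgK.
by apply: osgM; [exact: osgM|exact: osgV].
Qed.

Implicit Types X Y : finGset H.

Lemma gs_actVK X g (x : X) : H g -> gs_act g (gs_act g^-1 x) = x.
Proof. by move=> Hg; rewrite -gs_actM ?mulgV ?gs_act1//; exact: osgV. Qed.

Lemma gs_act_inj X g : H g -> injective (gs_act g : X -> X).
Proof. by move=> Hg; apply: (@can_inj _ _ _ (gs_act g^-1)) => x; rewrite gs_act_inv. Qed.

Lemma gs_act_bij X g : H g -> bijective (gs_act g : X -> X).
Proof.
by move=> Hg; exists (gs_act g^-1) => x; [rewrite gs_act_inv|rewrite gs_actVK].
Qed.

Lemma gorbitP X (x y : X) : reflect (exists2 g, H g & gs_act g x = y) (y \in gorbit x).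
Proof. exact: asboolP. Qed.

Lemma gorbit_refl X (x : X) : x \in gorbit x.
Proof. by apply/gorbitP; exists 1; [exact: osg1|rewrite gs_act1]. Qed.

Lemma gorbit_act X g (x y : X) : H g -> (gs_act g y \in gorbit x) = (y \in gorbit x).
Proof.
move=> Hg; apply/gorbitP/gorbitP => -[h Hh e].
  exists (g^-1 * h); first exact: osgM (osgV Hg) Hh.
  by rewrite gs_actM ?e ?gs_act_inv //; exact: osgV.
by exists (g * h); [exact: osgM|rewrite gs_actM ?e].
Qed.

Lemma gorbit_act_eq X g (x : X) : H g -> gorbit (gs_act g x) =i gorbit x.
Proof.
move=> Hg y; apply/gorbitP/gorbitP => -[h Hh e].
  by exists (h * g); [exact: osgM|rewrite gs_actM].
exists (h * g^-1); first by apply: osgM => //; exact: osgV.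
by rewrite gs_actM ?gs_act_inv //; exact: osgV.
Qed.

Lemma gorbit_eq X (x y : X) : y \in gorbit x -> gorbit y =i gorbit x.
Proof. by move=> /gorbitP[g Hg <-]; exact: gorbit_act_eq. Qed.

Lemma gorbit_sym X (x y : X) : (y \in gorbit x) = (x \in gorbit y).
Proof. by apply/idP/idP => /gorbit_eq; [move=> ->|move=> ->]; exact: gorbit_refl. Qed.

Lemma card_gorbit_gt0 X (x : X) : (0 < #|gorbit x|)%N.
Proof. by apply/card_gt0P; exists x; exact: gorbit_refl. Qed.

Lemma card_gorbit_neq0 X (x : X) : (#|gorbit x|%:R != 0 :> rat)%R.
Proof. by rewrite Num.Theory.pnatr_eq0 -lt0n card_gorbit_gt0. Qed.

(** The map sending g x to g y is well defined on orbits and onto; it gives the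
    orbit-stabiliser principle without mentioning indices of subgroups. *)
Lemma card_gorbit_le X Y (x : X) (y : Y) :
  stab x `<=` stab y -> (#|gorbit y| <= #|gorbit x|)%N.
Proof.
move=> sub; pose f (z : X) : Y :=
  gs_act (xget 1 [set g | H g /\ gs_act g x = z]) y.
apply: leq_trans (leq_image_card f (gorbit x)).
apply/subset_leq_card/fintype.subsetP => z /gorbitP[g Hg <-].
apply/fintype.imageP; exists (gs_act g x); first by rewrite gorbit_act // gorbit_refl.
have [] : [set h | H h /\ gs_act h x = gs_act g x]
    (xget 1 [set h | H h /\ gs_act h x = gs_act g x]) by apply: xgetPex; exists g.
rewrite /f; set h := xget _ _ => Hh e; have Hh' := osgV Hh.
have [_] : stab y (h^-1 * g).
  by apply: sub; split; [exact: osgM|rewrite gs_actM // -e gs_act_inv].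
by move=> /(congr1 (gs_act h)); rewrite gs_actM // gs_actVK.
Qed.

Lemma card_gorbit_stab X Y (x : X) (y : Y) :
  stab x = stab y -> #|gorbit x| = #|gorbit y|.
Proof. by move=> e; apply/eqP; rewrite eqn_leq !card_gorbit_le// e. Qed.

End Orbits.

Section RestrictedSet.
Local Open Scope group_scope.
Variables (G : topologicalGroupType) (H J : openSubgroup G).
Hypothesis sJH : J `<=` H.
Variable X : finGset H.

Fact gset_res_actM g h (x : X) :
  J g -> J h -> gs_act (g * h) x = gs_act g (gs_act h x).
Proof. by move=> /sJH Hg /sJH Hh; exact: gs_actM. Qed.

Fact gset_res_cont (x y : X) : open [set g | J g /\ gs_act g x = y].
Proof.
have -> : [set g | J g /\ gs_act g x = y] = J `&` [set g | H g /\ gs_act g x = y].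
  apply/seteqP; split=> g /= [Jg]; last by case.
  by move=> e; split=> //; split=> //; exact: sJH.
by apply: openI; [exact: osg_open|exact: gs_cont].
Qed.

Definition gset_res : finGset J :=
  @FinGset G J (gs_car X) (gs_fin X) _ (@gs_act1 _ _ X) gset_res_actM gset_res_cont.

Lemma stab_gset_res (x : X) : @stab _ _ gset_res x = J `&` stab x :> set G.
Proof.
apply/seteqP; split=> g /= [Jg]; last by case.
by move=> e; split=> //; split=> //; exact: sJH.
Qed.

Lemma gorbit_gset_res_sub (x y : X) : y \in @gorbit _ _ gset_res x -> y \in gorbit x.
Proof.
move=> /gorbitP[g Jg e]; apply/gorbitP; exists g => //; exact: sJH.
Qed.

(** The double cosets in J\H/S, for S the stabiliser of x, are the J-orbits
    in the H-orbit of x, through g |-> g x.  Weighting by the inverse of the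
    size of the J-orbit turns a sum over chosen representatives into a sum over
    all points, which is how [gset_act] is written. *)
Lemma sum_double_coset_reps (V : lmodType rat) (x : X) (F : X -> V) :
  (forall g y, J g -> F (gs_act g y) = F y) ->
  exists xs, double_coset_reps J H (stab x) xs /\
    (\sum_(g <- xs) F (gs_act g x) =
     \sum_(y in gorbit x) (#|@gorbit _ _ gset_res y|%:R)^-1 *: F y)%R.
Proof.
move=> FJ.
(* The pick only depends on the J-orbit as a predicate, hence [r] is a
   canonical choice of one point in each J-orbit. *)
pose r (y : X) : X := odflt y [pick z in @gorbit _ _ gset_res y].
have rP y : r y \in @gorbit _ _ gset_res y.
  by rewrite /r; case: pickP => //= /(_ y); rewrite (@gorbit_refl _ _ gset_res).
have r_eq y z : (r y == r z) = (z \in @gorbit _ _ gset_res y).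
  apply/eqP/idP => [e|yz].
    by rewrite -(gorbit_eq (rP y)) e gorbit_sym rP.
  rewrite /r (eq_pick (Q := fun t => t \in @gorbit _ _ gset_res y)); last first.
    by move=> t; rewrite (gorbit_eq yz).
  by case: pickP => //= /(_ y); rewrite (@gorbit_refl _ _ gset_res).
have rK y : r (r y) = r y by apply/esym/eqP; rewrite r_eq rP.
pose s (y : X) := xget 1 [set g | H g /\ gs_act g x = y].
have sP y : y \in gorbit x -> H (s y) /\ gs_act (s y) x = y.
  move=> /gorbitP[g Hg e].
  suff : [set g | H g /\ gs_act g x = y] (s y) by [].
  by apply: xgetPex; exists g.
pose D := [seq y <- index_enum X | (y \in gorbit x) && (r y == y)].
have DE y : (y \in D) = (y \in gorbit x) && (r y == y).
  by rewrite mem_filter mem_index_enum andbT.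
exists [seq s y | y <- D]; split.
  split.
  - rewrite map_inj_in_uniq ?filter_uniq ?index_enum_uniq// => y z.
    rewrite !DE => /andP[/sP[_ ey] _] /andP[/sP[_ ez] _] e.
    by rewrite -ey e ez.
  - by move=> _ /mapP[y + ->]; rewrite DE => /andP[/sP[]].
  - move=> h Hh; set y := gs_act h x.
    have xy : y \in gorbit x by rewrite gorbit_act // gorbit_refl.
    have xr : r y \in gorbit x by rewrite -(gorbit_eq xy) gorbit_gset_res_sub.
    have [Hs es] := sP _ xr.
    exists (s (r y)); split.
      split; first by apply/map_f; rewrite DE xr rK eqxx.
      have /gorbitP[j Jj ej] : y \in @gorbit _ _ gset_res (r y).
        by rewrite (@gorbit_sym _ _ gset_res).
      have Hjs : H (j * s (r y)) by apply: osgM => //; exact: sJH.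
      exists j, ((j * s (r y))^-1 * h); split=> //; last by rewrite mulVKg.
      split; first by apply: osgM => //; exact: osgV.
      rewrite gs_actM //; last exact: osgV.
      have {}ej : @gs_act _ _ X j (r y) = y by [].
      have -> : gs_act h x = gs_act (j * s (r y)) x.
        by rewrite gs_actM ?es//; exact: sJH.
      by rewrite gs_act_inv.
    move=> _ [/mapP[z + ->]] [j [l [Jj [Hl lx] eh]]].
    rewrite DE => /andP[xz /eqP rz]; have [Hz ez] := sP _ xz.
    have yz : y \in @gorbit _ _ gset_res z.
      apply/gorbitP; exists j => //=; rewrite /y eh.
      by rewrite !gs_actM ?lx ?ez //; [exact: sJH|apply: osgM => //; exact: sJH].
    by rewrite -rz; congr s; apply/eqP; rewrite eq_sym r_eq.
rewrite big_map big_filter.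
rewrite (eq_bigr F); last by move=> y /andP[/sP[_ ->]].
rewrite [RHS](partition_big r (fun z => (z \in gorbit x) && (r z == z))) /=; last first.
  by move=> y xy; rewrite rK eqxx andbT -(gorbit_eq xy) gorbit_gset_res_sub.
apply: eq_bigr => z /andP[xz /eqP rz].
rewrite (eq_bigl (mem (@gorbit _ _ gset_res z))); last first.
  move=> y; rewrite -[in r y == z]rz eq_sym r_eq.
  apply: andb_idl => zy.
  by rewrite -(gorbit_eq xz) gorbit_gset_res_sub.
rewrite (eq_bigr (fun=> (#|@gorbit _ _ gset_res z|%:R)^-1 *: F z))%R.
  rewrite sumr_const -scaler_nat scalerA divff ?scale1r//.
  exact: card_gorbit_neq0.
move=> y zy; rewrite (eq_card (gorbit_eq zy)).
by have /gorbitP[g Jg <-] := zy; rewrite FJ.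
Qed.

End RestrictedSet.

(** * The action of finite H-sets on a Mackey functor *)
Section ActionRestriction.
Local Open Scope group_scope.
Variables (G : topologicalGroupType) (M : mackeyFunctor G).
Implicit Types H J K S : openSubgroup G.

(** On elements restricted from M(H) the conjugation maps of the double coset
    formula disappear, since conjugation by an element of H is trivial on
    M(H). *)
Lemma mky_res_ind_res H J S (sJH : J `<=` H) (sSH : S `<=` H) xs (m : M H) :
  double_coset_reps J H S xs ->
  mky_res M sJH (mky_ind M sSH (mky_res M sSH m)) =
  (\sum_(x <- xs) mky_ind M (@cap_conj_sub G J S x)
     (mky_res M (@cap_conj_sub G J S x) (mky_res M sJH m)))%R.
Proof.
move=> rxs; rewrite (mky_double_coset sJH sSH rxs) big_seq [RHS]big_seq.
have [_ xsH _] := rxs; apply: eq_bigr => x /xsH Hx; congr (mky_ind _ _ _).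
have s : osg_cap S (osg_conj x^-1 J) `<=` H.
  exact: subset_trans (@cap_conj_sub _ _ _ _) sSH.
have s' : osg_cap J (osg_conj x S) `<=` H.
  exact: subset_trans (@cap_conj_sub _ _ _ _) sJH.
rewrite -(mky_res_comp sSH _ s) -(mky_res_comp sJH _ s').
by rewrite -(mky_res_conj s s' (conj_set_id Hx)) mky_conj_id.
Qed.

Lemma ind_res_conj H K K' g (sK : K `<=` H) (sK' : K' `<=` H) (m : M H) :
  H g -> K' = conj_set g K :> set G ->
  mky_ind M sK' (mky_res M sK' m) = mky_ind M sK (mky_res M sK m).
Proof.
move=> Hg e; rewrite -{1}[m](mky_conj_id (conj_set_id Hg)) //.
by rewrite (mky_res_conj sK _ _ e) (mky_ind_conj sK _ (conj_set_id Hg) e) mky_conj_id.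
Qed.

Lemma stab_act H (X : finGset H) g (x : X) : H g ->
  stab (gs_act g x) = conj_set g (stab x) :> set G.
Proof.
move=> Hg; have Hg' := osgV Hg; apply/seteqP; split=> h; rewrite conj_setE /=.
  move=> [Hh e]; split; first by apply: osgM => //; exact: osgM.
  by rewrite !gs_actM ?e ?gs_act_inv //; exact: osgM.
set k := g^-1 * h * g => -[Hk e].
have eh : h = g * k * g^-1 by rewrite /k !mulgA mulgV mul1g mulgK.
have Hh : H h by rewrite eh; apply: osgM => //; exact: osgM.
by split=> //; rewrite -gs_actM // eh mulgVK gs_actM // e.
Qed.

Lemma cap_conj_stab H J (sJH : J `<=` H) (X : finGset H) g (x : X) : H g ->
  osg_cap J (osg_conj g (stab x)) = @stab _ _ (gset_res sJH X) (gs_act g x) :> set G.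
Proof. by move=> Hg; rewrite stab_gset_res (stab_act x Hg). Qed.

(** Orbit by orbit this is the double coset formula: the group J :&: g S g^-1
    is the stabiliser in J of the point g x. *)
Lemma mky_res_gset_act H J (sJH : J `<=` H) (X : finGset H) (m : M H) :
  mky_res M sJH (gset_act m X) = gset_act (mky_res M sJH m) (gset_res sJH X).
Proof.
set m' := mky_res M sJH m; pose XJ := gset_res sJH X.
pose F (y : X) : M J := mky_ind M (@stab_sub _ _ XJ y) (mky_res M (@stab_sub _ _ XJ y) m').
have FJ g y : J g -> F (gs_act g y) = F y.
  move=> Jg; apply: (ind_res_conj _ _ _ Jg); exact: (@stab_act J XJ).
rewrite /gset_act linear_sum /=.
(* After exchanging the sums, each y is counted once for each x in its H-orbit,
   with weight the inverse of the size of that orbit. *)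
transitivity (\sum_(x : X) \sum_(y in gorbit x)
    (#|gorbit x|%:R)^-1 *: ((#|@gorbit _ _ XJ y|%:R)^-1 *: F y))%R.
  apply: eq_bigr => x _; rewrite linearZ /= -scaler_sumr; congr (_ *: _)%R.
  have [xs [rxs <-]] := sum_double_coset_reps sJH x FJ.
  rewrite (mky_res_ind_res _ _ _ rxs) big_seq [RHS]big_seq.
  have [_ xsH _] := rxs; apply: eq_bigr => g /xsH Hg.
  exact/ind_res_eq/cap_conj_stab.
rewrite (exchange_big_dep xpredT) //=; apply: eq_bigr => y _.
rewrite (eq_bigl (mem (gorbit y))); last by move=> x /=; exact: gorbit_sym.
rewrite (eq_bigr (fun=> (#|gorbit y|%:R)^-1 *: ((#|@gorbit _ _ XJ y|%:R)^-1 *: F y))%R).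
  by rewrite sumr_const -scaler_nat scalerA divff ?scale1r// card_gorbit_neq0.
by move=> x yx; rewrite (eq_card (gorbit_eq yx)).
Qed.

(** The orbit of (x, y) fibres over the orbit of x, the fibre over g x being
    the translate by g of the orbit of y under the stabiliser of x. *)
Lemma card_gorbit_prod H (X Y : finGset H) (x : X) (y : Y) :
  (#|@gorbit _ _ (gset_prod X Y) (x, y)| =
   #|gorbit x| * #|@gorbit _ _ (gset_res (@stab_sub _ _ X x) Y) y|)%N.
Proof.
set P := gset_prod X Y; set YS := gset_res _ Y.
rewrite -sum1_card.
rewrite (partition_big (fst : X * Y -> X) (mem (gorbit x))) /=; last first.
  by move=> p /gorbitP[g Hg <-]; rewrite gorbit_act // gorbit_refl.
rewrite -sum_nat_const; apply: eq_bigr => x' /gorbitP[g Hg ex].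
rewrite -sum1_card (reindex (fun z : Y => (x', gs_act g z) : P)) /=; last first.
  exists (fun p : X * Y => gs_act g^-1 p.2) => [z _|[a b] /andP[_ /eqP /= ->]] /=.
    by rewrite gs_act_inv.
  by rewrite gs_actVK.
apply: eq_bigl => z; rewrite eqxx andbT -ex.
rewrite [LHS](_ : _ = ((@gs_act _ _ P g (x, z) : P) \in @gorbit _ _ P (x, y))) //.
rewrite gorbit_act //; apply/gorbitP/gorbitP => -[h].
  by move=> Hh [ehx ehz]; exists h.
by move=> [Hh ehx] ehz; exists h => //=; rewrite /prod_act /= ehx; congr pair.
Qed.

(** Pushing the action of Y through the restriction to the stabiliser of x
    produces the stabilisers of the pairs (x, y), and the weights agree by
    [card_gorbit_prod]. *)
Lemma gset_act_prod H (X Y : finGset H) (m : M H) :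
  gset_act (gset_act m Y) X = gset_act m (gset_prod X Y).
Proof.
rewrite /gset_act -/(gset_act m Y).
pose f (p : gset_prod X Y) : M H := ((#|gorbit p|%:R)^-1 *:
  mky_ind M (@stab_sub _ _ _ p) (mky_res M (@stab_sub _ _ _ p) m))%R.
rewrite [RHS](_ : _ = \sum_(p : X * Y) f (p.1, p.2))%R; last first.
  by apply: eq_bigr => -[].
rewrite -(pair_bigA _ (fun (x : X) (y : Y) => f (x, y))) /=.
apply: eq_bigr => x _; rewrite mky_res_gset_act /gset_act linear_sum /= scaler_sumr.
apply: eq_bigr => y _; rewrite /f linearZ /= scalerA card_gorbit_prod.
rewrite natrM invfM; congr (_ *: _)%R.
set sS := stab_sub (x := x); set sT := @stab_sub _ _ (gset_res _ _) y.
have sTH : @stab _ _ (gset_res sS Y) y `<=` H := subset_trans sT sS.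
rewrite -(mky_res_comp _ _ sTH) -(mky_ind_comp _ _ sTH).
apply: ind_res_eq; rewrite stab_gset_res; apply/seteqP; split=> g /=.
  by move=> [[Hg ex] [_ ey]]; split=> //; exact: (congr2 pair ex ey).
by move=> [Hg [ex ey]].
Qed.

Lemma gset_act_linear H (X : finGset H) : linear (fun m : M H => gset_act m X).
Proof.
move=> c m m'; rewrite /gset_act scaler_sumr -big_split /=.
apply: eq_bigr => x _; rewrite 2!linearP /= scalerDr !scalerA.
by rewrite [(c * _)%R]mulrC.
Qed.

End ActionRestriction.

(** * Marks, and the action of the Burnside ring *)
Section TriangularInversion.
Local Open Scope ring_scope.
Variables (T : eqType) (le : rel T) (V : lmodType rat) (phi : T -> V).
Hypotheses (le_refl : reflexive le) (le_anti : antisymmetric le)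
  (le_trans : transitive le).
Variable W : seq (rat * T).

Let D := undup [seq p.2 | p <- W].

Lemma sum_by_snd (U : nmodType) (P : pred T) (F : rat * T -> U) :
  \sum_(p <- W | P p.2) F p = \sum_(S <- D | P S) \sum_(p <- W | p.2 == S) F p.
Proof.
rewrite (exchange_big_dep (fun p => P p.2)) /=; last by move=> S p PS /eqP->.
rewrite big_seq_cond [RHS]big_seq_cond; apply: eq_bigr => p /andP[pW Pp].
rewrite (eq_bigl (fun S => S == p.2)); last first.
  move=> S; rewrite eq_sym andbC; case: eqP => //= ->; exact: Pp.
by rewrite -big_filter filter_pred1_uniq ?big_seq1 ?undup_uniq // mem_undup map_f.
Qed.

(** A coefficient is determined by its upper sum and by the coefficients that
    lie strictly above it, whence a downward induction. *)
Lemma upper_sums_eq0 :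
  (forall S, S \in [seq p.2 | p <- W] -> \sum_(p <- W | le S p.2) p.1 = 0) ->
  \sum_(p <- W) p.1 *: phi p.2 = 0.
Proof.
move=> up0; pose f S := \sum_(p <- W | p.2 == S) p.1.
have f0 S : S \in D -> f S = 0.
  pose above S := [seq S' <- D | le S S' && (S' != S)].
  have [n] := ubnP (size (above S)); elim: n S => // n IH S leSn SD.
  have := up0 S; rewrite -mem_undup -/D => /(_ SD).
  rewrite (bigID (fun p => p.2 == S)) /= [X in _ + X](_ : _ = 0); last first.
    rewrite (sum_by_snd (fun S' => le S S' && (S' != S))) big_seq_cond.
    apply: big1 => S' /and3P[S'D leSS' neSS']; apply: IH => //.
    rewrite -ltnS; apply: leq_trans leSn; rewrite ltnS.
    apply: (@uniq_leq_size _ (S' :: above S')).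
      by rewrite /= mem_filter eqxx andbF /= filter_uniq // undup_uniq.
    move=> S''; rewrite inE => /predU1P[->|]; first by rewrite mem_filter leSS' neSS'.
    rewrite !mem_filter => /andP[/andP[leS'S'' neS'S''] ->]; rewrite andbT.
    rewrite (le_trans leSS' leS'S''); apply: contraNneq neSS' => e.
    by apply/eqP/le_anti; rewrite -{1}e leS'S''.
  rewrite addr0 => <-; apply: eq_bigl => p.
  by case: eqP => [->|]; rewrite ?le_refl ?andbF.
rewrite (sum_by_snd xpredT) big_seq big1 // => S SD.
rewrite (eq_bigr (fun p => p.1 *: phi S)) => [|p /eqP-> //].
by rewrite -scaler_suml -/(f S) f0 // scale0r.
Qed.

End TriangularInversion.

HB.instance Definition _ (G : topologicalGroupType) := gen_eqMixin (openSubgroup G).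
HB.instance Definition _ (G : topologicalGroupType) := gen_choiceMixin (openSubgroup G).

Lemma open_subgroup_closed (G : topologicalGroupType) (K : openSubgroup G) :
  closed (K : set G).
Proof.
rewrite -openC openE => g nKg; rewrite /interior nbhsE /=.
exists [set x | K (g^-1 * x)%g].
  split; last by rewrite /= mulVg; exact: osg1.
  apply: open_comp (@osg_open _ K) => x _; exact: mulgl_continuous.
move=> x /= Kgx Kx; apply: nKg.
have -> : g = (x * (g^-1 * x)^-1)%g by rewrite invgM invgK mulVKg.
by apply: osgM => //; exact: osgV.
Qed.

Section Marks.
Local Open Scope ring_scope.
Variables (G : topologicalGroupType) (H : openSubgroup G).
Implicit Types (a b : burnside H) (L : set G) (X Y : finGset H).

Lemma markE L (s : fsum H) : L `<=` H ->
  mark L (bpi s) = \sum_(t <- s) t.1 * gset_mark L t.2.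
Proof.
move=> LH; apply: (@burnside_liftE _ _ _ (gset_mark L)); last by move=> X Y; exact: gset_mark_sum.
by move=> X Y; exact: gset_mark_iso.
Qed.

Lemma mark_linear L : L `<=` H -> linear (mark L : burnside H -> rat^o).
Proof.
move=> LH; apply: burnside_lift_linear; last by move=> X Y; exact: gset_mark_sum.
by move=> X Y; exact: gset_mark_iso.
Qed.

Lemma markB L a b : L `<=` H -> mark L (a - b) = mark L a - mark L b.
Proof.
move=> LH; rewrite [a - b]addrC -[- b]scaleN1r.
by rewrite [LHS](mark_linear LH) scaleN1r addrC.
Qed.

Lemma markZ L c a : L `<=` H -> mark L (c *: a) = c * mark L a.
Proof.
move=> LH; have m0 : mark L (0 : burnside H) = 0.
  by rewrite -(subrr (0 : burnside H)) markB // subrr.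
by have := mark_linear LH c a 0; rewrite m0 !addr0.
Qed.

Lemma gset_mark_prod L X Y :
  gset_mark L (gset_prod X Y) = gset_mark L X * gset_mark L Y.
Proof.
rewrite /gset_mark -[RHS]natrM; congr (_%:R); rewrite -cardX.
apply: eq_card => -[x y]; rewrite !inE /=.
apply/asboolP/andP => [fixp|[/asboolP fx /asboolP fy] l Ll].
  by split; apply/asboolP => l /fixp; rewrite /= /prod_act /= => -[].
by rewrite /= /prod_act /= fx ?fy.
Qed.

Lemma markM L a b : L `<=` H -> mark L (a * b) = mark L a * mark L b.
Proof.
move=> LH; elim/bpi_ind: a => s; elim/bpi_ind: b => t.
rewrite -[(_ * _) in LHS]/(bmul _ _) bmulE !markE //.
rewrite /fsum_mul big_allpairs_dep mulr_suml; apply: eq_bigr => p _.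
rewrite mulr_sumr; apply: eq_bigr => q _ /=.
by rewrite gset_mark_prod mulrACA.
Qed.

Lemma mark1 L : L `<=` H -> mark L (1 : burnside H) = 1.
Proof.
move=> LH; rewrite -[1 in LHS]/(bone H) markE // big_seq1 mul1r /gset_mark.
by rewrite (eq_card (B := predT)) ?card_unit // => x; rewrite !inE; apply/asboolP.
Qed.

(** If a has marks in {0, ..., n}, this is the element whose marks are the
    characteristic function of the zeros of the marks of a: the polynomial
    prod_i (1 - t / i), for 1 <= i <= n, is 1 at t = 0 and vanishes at
    1, ..., n. *)
Definition zero_locus n a : burnside H := \prod_(i < n) (1 - (i.+1%:R)^-1 *: a).

Lemma mark_zero_locus L n k a : L `<=` H -> mark L a = k%:R -> (k <= n)%N ->
  mark L (zero_locus n a) = (k == 0%N)%:R.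
Proof.
move=> LH ak kn; rewrite /zero_locus.
rewrite (big_morph (mark L) (fun a b => markM a b LH) (mark1 LH)).
under eq_bigr do rewrite markB // mark1 // markZ // ak.
case: k kn {ak} => [_|k kn]; first by rewrite big1 // => i _; rewrite mulr0 subr0.
rewrite (bigD1 (Ordinal kn)) //= mulVf ?subrr ?mul0r //.
by rewrite Num.Theory.pnatr_eq0.
Qed.

End Marks.

Section BurnsideAction.
Local Open Scope ring_scope.
Variables (G : topologicalGroupType) (M : mackeyFunctor G) (H : openSubgroup G).
Implicit Types (a b : burnside H) (m : M H).

Lemma burnside_actE (s : fsum H) m :
  burnside_act (bpi s) m = \sum_(t <- s) t.1 *: gset_act m t.2.
Proof. exact: burnside_liftE (@gset_act_iso _ _ _ m) (@gset_act_sum _ _ _ m) s. Qed.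

(** Collect the points of all the finite sets in a formal sum according to their
    stabilisers S.  The total coefficient of each I_S R_S m is zero, because
    the mark at S is the sum of the coefficients of the stabilisers containing S:
    the table of marks is triangular. *)
Lemma burnside_act_mark0 a m :
  (forall L : closedSubgroup H, mark L a = 0) -> burnside_act a m = 0.
Proof.
elim/bpi_ind: a => s mark0; rewrite burnside_actE.
pose W := [seq (t.1, @stab _ _ t.2 x) | t <- s, x <- index_enum t.2].
pose phi S := xget 0 [set v : M H | exists (X : finGset H) (x : X), stab x = S /\
  v = (#|gorbit x|%:R)^-1 *: mky_ind M (@stab_sub _ _ _ x) (mky_res M (@stab_sub _ _ _ x) m)].
(* [phi] sends a stabiliser to its contribution; this is well defined as the size
   of an orbit depends only on the stabiliser of a point. *)
have phiE (X : finGset H) (x : X) : phi (stab x) = (#|gorbit x|%:R)^-1 *: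
    mky_ind M (@stab_sub _ _ _ x) (mky_res M (@stab_sub _ _ _ x) m).
  rewrite /phi; case: xgetP => [v _ [Y [y [e ->]]]|]; last first.
    by move=> /(_ _ (ex_intro _ X (ex_intro _ x (conj erefl erefl)))).
  by rewrite (card_gorbit_stab e); congr (_ *: _); apply: ind_res_eq; rewrite e.
pose le (S S' : openSubgroup G) := `[< S `<=` S' >].
rewrite (_ : \sum_(t <- s) _ = \sum_(p <- W) p.1 *: phi p.2); last first.
  rewrite /W big_allpairs_dep; apply: eq_bigr => t _; rewrite -scaler_sumr.
  by congr (_ *: _); apply: eq_bigr => x _; rewrite phiE.
apply: (@upper_sums_eq0 _ le).
- by move=> S; apply/asboolP.
- move=> S S' /andP[/asboolP h /asboolP h']; apply: osg_inj.
  by apply/seteqP.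
- by move=> S S' S'' /asboolP h /asboolP h'; apply/asboolP/(subset_trans h).
move=> _ /mapP[_ /allpairsPdep[t0 [x0 [_ _ ->]]] ->] /=; set S := stab x0.
have SH : S `<=` H := @stab_sub _ _ _ x0.
rewrite -[RHS](mark0 (ClosedSubgroup (osg_subgroup S) (@open_subgroup_closed _ S) SH)) /=.
rewrite markE // /W [LHS]big_mkcond big_allpairs_dep; apply: eq_bigr => t _ /=.
rewrite /gset_mark -sum1_card natr_sum mulr_sumr [RHS]big_mkcond /=.
apply: eq_bigr => x _; rewrite mulr1 inE; congr (if _ then _ else _).
apply/asboolP/asboolP => [sub l /sub [] //|fixx l Sl].
by split; [exact: SH|exact: fixx].
Qed.

Lemma burnside_act_eq a b m :
  (forall L : closedSubgroup H, mark L a = mark L b) ->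
  burnside_act a m = burnside_act b m.
Proof.
move=> eab; apply/eqP; rewrite -subr_eq0; apply/eqP.
rewrite addrC -scaleN1r -burnside_act_linear; apply/eqP; rewrite burnside_act_mark0 // => L.
by rewrite scaleN1r addrC markB ?eab ?subrr //; exact: csg_sub.
Qed.

Lemma burnside_act_linearr a : linear (burnside_act a : M H -> M H).
Proof.
elim/bpi_ind: a => s c m m'; rewrite !burnside_actE scaler_sumr -big_split /=.
apply: eq_bigr => t _; rewrite gset_act_linear scalerDr !scalerA.
by rewrite [c * _]mulrC.
Qed.

HB.instance Definition _ a :=
  GRing.isLinear.Build rat (M H) (M H) *:%R (burnside_act a) (burnside_act_linearr a).

Lemma burnside_actM a b m : burnside_act (a * b) m = burnside_act a (burnside_act b m).
Proof.
elim/bpi_ind: a => s; elim/bpi_ind: b => t.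
rewrite -[_ * _]/(bmul _ _) bmulE !burnside_actE /fsum_mul big_allpairs_dep.
apply: eq_bigr => p _; pose f : M H -> M H := fun m => gset_act m p.2.
pose fL : {linear M H -> M H} := HB.pack f
  (GRing.isLinear.Build rat (M H) (M H) *:%R f (gset_act_linear p.2)).
have -> : gset_act (\sum_(q <- t) q.1 *: gset_act m q.2) p.2 =
    \sum_(q <- t) q.1 *: gset_act m (gset_prod p.2 q.2).
  rewrite -[LHS]/(fL _) linear_sum; apply: eq_bigr => q _.
  by rewrite linearZ /= /f gset_act_prod.
by rewrite scaler_sumr; apply: eq_bigr => q _; rewrite scalerA.
Qed.

Lemma burnside_act1 m : burnside_act 1 m = m.
Proof.
rewrite -[1]/(bone H) burnside_actE big_seq1 scale1r /gset_act.
pose P := gset_point H; rewrite (big_pred1 (tt : P)); last by case.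
have -> : #|@gorbit _ _ P tt| = 1%N.
  rewrite (eq_card (B := pred1 (tt : P))) ?card1 // => -[].
  by rewrite [LHS](@gorbit_refl _ _ P).
rewrite invr1 scale1r.
have sHH : H `<=` H by [].
rewrite (@ind_res_eq _ _ _ _ H _ sHH) ?mky_ind_id ?mky_res_id //.
by apply/seteqP; split=> g; [case|].
Qed.

(** Only the constant term 1 of the polynomial [zero_locus] acts on an element
    killed by a. *)
Lemma burnside_act_zero_locus n a m :
  burnside_act a m = 0 -> burnside_act (zero_locus n a) m = m.
Proof.
move=> am0; rewrite /zero_locus; elim: n => [|n IH]; first by rewrite big_ord0 burnside_act1.
rewrite big_ord_recr /= burnside_actM addrC -scaleNr burnside_act_linear am0.
by rewrite scaler0 add0r burnside_act1.
Qed.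

End BurnsideAction.

Section BurnsideRestriction.
Local Open Scope ring_scope.
Variables (G : topologicalGroupType) (H K : openSubgroup G) (sKH : K `<=` H).

(** Restriction is defined on a representative, as only its marks and its action
    matter, and neither depends on that choice. *)
Definition burnside_res (a : burnside H) : burnside K :=
  bpi [seq (t.1, gset_res sKH t.2) | t <- repr a].

Lemma mark_burnside_res L a : L `<=` K -> mark L (burnside_res a) = mark L a.
Proof.
move=> LK; rewrite -[a in RHS]reprK !markE ?big_map //.
exact: subset_trans sKH.
Qed.

Lemma burnside_act_res (M : mackeyFunctor G) a (m : M H) :
  mky_res M sKH (burnside_act a m) = burnside_act (burnside_res a) (mky_res M sKH m).
Proof.
rewrite -[a in LHS]reprK !burnside_actE linear_sum big_map /=.
by apply: eq_bigr => t _; rewrite linearZ /= mky_res_gset_act.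
Qed.

End BurnsideRestriction.

(** * Conjugates of open subgroups *)
Section ConjugateSubgroups.
Local Open Scope group_scope.
Variable G : topologicalGroupType.
Implicit Types (A B : set G) (g h : G) (H K N J : openSubgroup G).

Lemma conj_set1 A : conj_set 1 A = A.
Proof. by apply/seteqP; split=> x; rewrite conj_setE invg1 mul1g mulg1. Qed.

Lemma conj_setM g h A : conj_set (g * h) A = conj_set g (conj_set h A).
Proof. by apply/seteqP; split=> x; rewrite !conj_setE invgM !mulgA. Qed.

Lemma conj_setS g A B : A `<=` B -> conj_set g A `<=` conj_set g B.
Proof. by move=> AB x; rewrite !conj_setE; exact: AB. Qed.

Lemma conj_setK g A : conj_set g^-1 (conj_set g A) = A.
Proof. by rewrite -conj_setM mulVg conj_set1. Qed.

Lemma conj_setVK g A : conj_set g (conj_set g^-1 A) = A.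
Proof. by rewrite -conj_setM mulgV conj_set1. Qed.

Lemma osgX H h n : H h -> H (h ^+ n).
Proof.
move=> Hh; elim: n => [|n IH]; first by rewrite expg0; exact: osg1.
by rewrite expgS; exact: osgM.
Qed.

(** Pigeonhole on the finitely many cosets of the powers of h. *)
Lemma exists_expg_mem H N h : profinite G -> H h -> exists n, N (h ^+ n.+1).
Proof.
move=> pG Hh; apply: contrapT => noN; pose f n := lcoset N (h ^+ n).
have ltf i j : (i < j)%N -> f i <> f j.
  move=> ij /lcoset_eq Nij; apply: noN; exists (j - i).-1.
  by rewrite prednK ?subn_gt0 //; move: Nij; rewrite -{1}(subnKC (ltnW ij)) expgnDr mulKg.
apply: infinite_nat; rewrite (_ : [set: nat] = f @^-1` lcosets_set H N).
  apply: finite_preimage (finite_lcosets H N pG) => i j _ _ eij.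
  by case: (ltngtP i j) => // /ltf; [case|move/(_ (esym eij))].
by apply/seteqP; split=> // n _; exists (h ^+ n) => //; exact: osgX.
Qed.

(** If K is contained in its conjugate by h, then it is contained in
    an increasing chain of conjugates by powers of h; some power lies in K, so
    that the chain comes back to K. *)
Lemma conj_set_eq_of_sub H N K h : profinite G -> N `<=` K -> H h ->
  K `<=` conj_set h K -> K = conj_set h K :> set G.
Proof.
move=> pG sNK Hh sK; have [n Nhn] := exists_expg_mem N pG Hh.
have sKn i : K `<=` conj_set (h ^+ i) K.
  elim: i => [|i IH]; first by rewrite expg0 conj_set1.
  by rewrite expgS conj_setM; apply: subset_trans sK _; exact: conj_setS.
apply/seteqP; split=> //.
rewrite {2}(conj_set_id (sNK _ Nhn)) expgS conj_setM.
by apply: conj_setS; exact: sKn.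
Qed.

End ConjugateSubgroups.

(** * Existence of the idempotents *)
Section Cosets.
Local Open Scope group_scope.
Variables (G : topologicalGroupType) (pG : profinite G).
Implicit Types H K N J : openSubgroup G.

Lemma coset_ptP H J h : H h ->
  exists x : coset_gset H J, val (x : coset_car H J) = lcoset J h :> set G.
Proof.
move=> Hh; have mem : lcoset J h \in coset_fset H J.
  by rewrite in_fset_set ?inE; [exists h|exact: finite_lcosets].
by exists (exist (fun C : G -> Prop => (C : set G) \in coset_fset H J) _ mem).
Qed.

Lemma stab_coset H J (x : coset_gset H J) h : H h ->
  val (x : coset_car H J) = lcoset J h :> set G -> 
  stab x = H `&` conj_set h J :> set G.
Proof.
move=> Hh ex; apply/seteqP; split=> g.
  move=> [Hg /(congr1 val)]; rewrite [LHS](coset_actE Hg Hh ex) ex.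
  by move=> /esym /lcoset_eq; rewrite mulgA => Jg; split=> //; rewrite conj_setE.
move=> [Hg gJ]; split=> //; apply/val_inj; rewrite [LHS](coset_actE Hg Hh ex) ex.
by apply/esym/lcoset_eq; move: gJ; rewrite conj_setE mulgA.
Qed.

(** The number of points bounds all marks of [H/J], and the mark of [H/J] at L
    vanishes exactly when L is not subconjugate to J. *)
Definition not_subconj H J : burnside H :=
  zero_locus #|coset_gset H J| (bclass (coset_gset H J)).

Lemma mark_not_subconj H J (L : set G) : L `<=` H ->
  mark L (not_subconj H J) = ((~~ `[< exists2 h, H h & L `<=` conj_set h J >])%:R)%R.
Proof.
move=> LH; rewrite (mark_zero_locus LH (mark_class _ LH)) ?max_card //.
congr (_%:R)%R; congr nat_of_bool.
rewrite -leqn0 leqNgt; congr (~~ _); apply/card_gt0P/asboolP => [[x]|[h Hh Lh]].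
  rewrite inE => fixx; have [h Hh ex] := coset_carP x.
  exists h => // l Ll; have : stab x l by split; [exact: LH|exact: fixx].
  by rewrite (stab_coset Hh ex) => -[].
have [x ex] := coset_ptP J Hh; exists x; rewrite inE => l Ll.
suff [] : stab x l by [].
by rewrite (stab_coset Hh ex); split; [exact: LH|exact: Lh].
Qed.

(** An open subgroup between N and H is determined by the cosets of N that it
    contains. *)
Lemma finite_overgroups H N : exists Js : seq (openSubgroup G),
  forall J, N `<=` J -> J `<=` H -> J \in Js.
Proof.
pose T := coset_gset H N.
pose U J : {ffun T -> bool} := [ffun x : T => `[< (val (x : coset_car H N) : set G) `<=` J >]].
exists [seq xget N [set J : openSubgroup G | [/\ N `<=` J, J `<=` H & U J = A]]
  | A <- index_enum {ffun T -> bool}].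
have U_sub J J' : N `<=` J -> J `<=` H -> U J = U J' -> J `<=` J'.
  move=> sNJ sJH e g Jg; have [x ex] := coset_ptP N (sJH _ Jg).
  have : U J x.
    rewrite ffunE; apply/asboolP; rewrite ex => y [n Nn <-].
    by apply: osgM => //; exact: sNJ.
  rewrite e ffunE => /asboolP; apply; rewrite ex.
  by exists 1; [exact: osg1|rewrite mulg1].
move=> J sNJ sJH; apply/mapP; exists (U J); first by rewrite mem_index_enum.
case: xgetP => [J' _ [sNJ' sJ'H e]|/(_ J)]; last by case.
by apply/osg_inj/seteqP; split; apply: U_sub.
Qed.

End Cosets.

Section Idempotents.
Local Open Scope group_scope.
Variables (G : topologicalGroupType) (pG : profinite G).
Variables (H N : openSubgroup G) (nNH : normal_in H N).
Implicit Types (K J : openSubgroup G) (L : closedSubgroup H).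

Definition mulset (A B : set G) : set G := [set a * b | a in A & b in B].

Lemma mulset_sub J (L : set G) : N `<=` J -> L `<=` J -> mulset N L `<=` J.
Proof. by move=> sNJ LJ _ [n Nn [l Ll <-]]; apply: osgM; [exact: sNJ|exact: LJ]. Qed.

Lemma sub_mulset_l (L : set G) : subgroup L -> N `<=` mulset N L.
Proof. by move=> sL n Nn; exists n => //; exists 1; [exact: sL.1|rewrite mulg1]. Qed.

Lemma sub_mulset_r (L : set G) : L `<=` mulset N L.
Proof. by move=> l Ll; exists 1; [exact: osg1|exists l; rewrite ?mul1g]. Qed.

Lemma mulset_subgroup L : subgroup (mulset N L).
Proof.
have sL := csg_subgroup L; split.
  by exists 1; [exact: osg1|exists 1; [exact: sL.1|rewrite mulg1]].
move=> _ _ [n Nn [l Ll <-]] [n' Nn' [l' Ll' <-]].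
set k := l * l'^-1; have Lk : L k by exact: sL.2.
exists (n * (k * n'^-1 * k^-1)).
  apply: osgM => //; rewrite -(nNH.2 _ (csg_sub Lk)); exists n'^-1 => //.
  exact: osgV.
by exists k => //; rewrite -(mulgA n) mulgVK /k invgM !mulgA.
Qed.

Lemma mulset_open L : open (mulset N L).
Proof.
have -> : mulset N L = \bigcup_(l in L) ((fun x => x * l^-1) @^-1` N).
  apply/seteqP; split=> [_ [n Nn [l Ll <-]]|x [l Ll /= Nx]].
    by exists l => //=; rewrite mulgK.
  by exists (x * l^-1) => //; exists l => //; rewrite mulgVK.
apply: bigcup_open => l _; apply: open_comp (@osg_open _ N) => x _.
exact: mulgr_continuous.
Qed.

Definition mul_osg L : openSubgroup G := OpenSubgroup (mulset_subgroup L) (@mulset_open L).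

Lemma conj_closed h (A : set G) : closed A -> closed (conj_set h A).
Proof.
rewrite -!openC => /(conj_set_open h); congr open.
by apply/seteqP; split=> x; rewrite /setC /= !conj_setE.
Qed.

Lemma conj_sub h L : H h -> conj_set h L `<=` H.
Proof. by move=> Hh; rewrite (conj_set_id Hh); apply: conj_setS; exact: csg_sub. Qed.

Definition csg_conj h L (Hh : H h) : closedSubgroup H :=
  ClosedSubgroup (conj_set_subgroup h (csg_subgroup L))
    (@conj_closed h _ (@csg_closed _ _ L)) (conj_sub Hh).

(** If N (h L h^-1) = K with L <= K, then h^-1 K h = N L <= K; as K cannot
    properly contain a conjugate of itself, N L = K. *)
Lemma NJ_saturation_sub K L : N `<=` K -> L `<=` K ->
  NJ_saturation N K L <-> mulset N L = K.
Proof.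
move=> sNK LK; split=> [[L' [NL' [h Hh eL']]]|NL]; last first.
  by exists L; split=> //; exists 1; [exact: osg1|rewrite conj_set1].
have sVK : conj_set h^-1 K `<=` mulset N L.
  move=> x; rewrite conj_setE invgK -NL' => -[n Nn [l' + e]].
  rewrite eL' => -[l Ll el]; exists (h^-1 * n * h).
    by rewrite -(nNH.2 _ (osgV Hh)) conj_setE invgK !mulgA mulgV mul1g mulgK.
  exists l => //; rewrite -[x](mulKg h) -[h * x](mulgVK h) -e -el.
  by rewrite !mulgA mulgVK.
have sK : K `<=` conj_set h K.
  rewrite -{1}(conj_setVK h K); apply: conj_setS.
  exact: subset_trans sVK (mulset_sub sNK LK).
have eK := conj_set_eq_of_sub pG sNK Hh sK.
apply/seteqP; split; first exact: mulset_sub.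
by rewrite -{1}(conj_setK h K) -eK.
Qed.

Variables (K : openSubgroup G) (sNK : N `<=` K).

(** Membership in the saturation in terms of subconjugacy alone, which is what the
    marks of the H-sets H/J detect. *)
Lemma NJ_saturationP L : NJ_saturation N K L <->
  (exists2 h, H h & L `<=` conj_set h K) /\
  forall J, N `<=` J -> J `<=` K -> J <> K ->
    ~ exists2 h, H h & L `<=` conj_set h J.
Proof.
split=> [[L' [NL' [h Hh eL']]]|[[h Hh Lh] noJ]].
  have L'K : L' `<=` K by rewrite -NL'; exact: sub_mulset_r.
  have LE : L = conj_set h^-1 L' :> set G by rewrite eL' conj_setK.
  split; first by exists h^-1; [exact: osgV|rewrite LE; exact: conj_setS].
  move=> J sNJ sJK neJK [g Hg Lg]; apply: neJK.
  have Hhg : H (h * g) by exact: osgM.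
  have KJ : K `<=` conj_set (h * g) J.
    rewrite -NL'; apply: (@mulset_sub (osg_conj (h * g) J)) => /=.
      by rewrite -(nNH.2 _ Hhg); exact: conj_setS.
    by rewrite eL' conj_setM; exact: conj_setS.
  have eK : K = conj_set (h * g) K :> set G.
    apply: conj_set_eq_of_sub pG sNK Hhg _.
    by apply: subset_trans KJ _; exact: conj_setS.
  apply/osg_inj/seteqP; split=> //.
  rewrite -[X in X `<=` _](conj_setK (h * g)) -eK -[X in _ `<=` X](conj_setK (h * g)).
  exact: conj_setS.
have Hh' := osgV Hh; pose L' := csg_conj L Hh'.
have L'K : L' `<=` K by rewrite -[X in _ `<=` X](conj_setK h); exact: conj_setS.
have eL : L = conj_set h L' :> set G by rewrite conj_setVK.
exists L'; split; last by exists h^-1.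
suff : mul_osg L' = K by move=> <-.
apply: contrapT => ne; apply: (noJ (mul_osg L')) => //.
- exact: sub_mulset_l (csg_subgroup L').
- exact: mulset_sub.
- by exists h => //; rewrite eL; apply: conj_setS; exact: sub_mulset_r.
Qed.

(** The witness is the product of the characteristic function of the L
    subconjugate to K and of those of the L not subconjugate to J, for J
    running over the proper subgroups of K that contain N. *)
Lemma burnside_idemP L :
  mark L (burnside_idem H N K) = ((L \in NJ_saturation N K)%:R)%R.
Proof.
move: L; apply: (@xgetPex _ 0%R [set a : burnside H | forall L : closedSubgroup H,
  mark L a = ((L \in NJ_saturation N K)%:R)%R]).
have [Js JsP] := finite_overgroups pG K N.
pose P J := `[< [/\ N `<=` J, J `<=` K & J <> K] >].
exists ((1 - not_subconj H K) * \prod_(J <- Js | P J) not_subconj H J)%R => L.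
have LH := @csg_sub _ _ L.
rewrite markM // markB // mark1 // mark_not_subconj //.
rewrite (big_morph (mark L) (fun a b => markM a b LH) (mark1 LH)).
under eq_bigr do rewrite mark_not_subconj //.
have -> : (1 - (~~ `[< exists2 h, H h & L `<=` conj_set h K >])%:R =
    (`[< exists2 h, H h & L `<=` conj_set h K >])%:R :> rat)%R.
  by case: asboolP => _; rewrite ?subr0 ?subrr.
case: (asboolP (exists2 h, H h & L `<=` conj_set h K)) => [LK|nLK]; last first.
  rewrite mul0r (_ : (_ \in _) = false) //; apply/negbTE/negP.
  by move=> /set_mem /NJ_saturationP[].
rewrite mul1r.
case: (boolP (L \in NJ_saturation N K)) => [/set_mem|/negP].
  move=> /NJ_saturationP[_ noJ]; apply: big1 => J /asboolP[sNJ sJK neJK].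
  by case: asboolP => // /(noJ _ sNJ sJK neJK).
move=> nsat; have [J [[sNJ sJK neJK] LJ]] : exists J,
    [/\ N `<=` J, J `<=` K & J <> K] /\ exists2 h, H h & L `<=` conj_set h J.
  apply: contrapT => noJ; apply: nsat; apply/mem_set/NJ_saturationP; split=> // J sNJ sJK neJK LJ.
  by apply: noJ; exists J.
rewrite (big_rem J) ?JsP //= (_ : P J) ?asboolT ?mul0r //.
by apply/asboolP.
Qed.

End Idempotents.

(** * Restriction of the idempotent summands *)
Section LargestSubgroup.
Local Open Scope group_scope.
Variables (G : topologicalGroupType) (pG : profinite G).
Variables (K N : openSubgroup G) (nNK : normal_in K N).

(** When K is the whole group, the conjugates disappear from the description of
    the saturation, K being normal in itself. *)
Lemma mark_burnside_idem_top (L : closedSubgroup K) :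
  mark L (burnside_idem K N K) = (`[< mulset N L = K >]%:R)%R.
Proof.
rewrite (burnside_idemP pG nNK nNK.1); congr (_%:R)%R; congr nat_of_bool.
apply/idP/asboolP.
  by move=> /set_mem /(NJ_saturation_sub pG nNK nNK.1 (@csg_sub _ _ L)).
move=> e; apply/mem_set.
exact/(NJ_saturation_sub pG nNK nNK.1 (@csg_sub _ _ L)).
Qed.

(** If N and L lie in J, so does N L: the idempotent has no mark below J. *)
Lemma res_idem_proper (J : openSubgroup G) (sJK : J `<=` K)
    (M : mackeyFunctor G) (n : M K) :
  N `<=` J -> J <> K -> mky_res M sJK (burnside_act (burnside_idem K N K) n) = 0%R.
Proof.
move=> sNJ neJK; rewrite burnside_act_res; apply: burnside_act_mark0 => L.
have LJ := @csg_sub _ _ L.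
rewrite mark_burnside_res // -[X in mark X]/(csg_set (ClosedSubgroup (csg_subgroup L)
  (@csg_closed _ _ L) (subset_trans LJ sJK))) mark_burnside_idem_top.
case: asboolP => //= NL; case: neJK; apply/osg_inj/seteqP; split=> //.
by rewrite -NL; exact: mulset_sub.
Qed.

End LargestSubgroup.

Section MackeyIdempotents.
Local Open Scope group_scope.
Variables (G : topologicalGroupType) (pG : profinite G) (M : mackeyFunctor G).
Variables (H K N : openSubgroup G).
Hypotheses (sKH : K `<=` H) (sNK : N `<=` K) (nNH : normal_in H N).

Lemma normal_in_sub : normal_in K N.
Proof. by split=> // k /sKH; exact: nNH.2. Qed.

Notation e := (burnside_idem H N K).
Notation e' := (burnside_idem K N K).

Lemma burnside_act_idem (m : M H) : burnside_act e (burnside_act e m) = burnside_act e m.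
Proof.
rewrite -burnside_actM; apply: burnside_act_eq => L.
rewrite markM ?(burnside_idemP pG nNH sNK) -?natrM ?mulnb ?andbb //.
exact: csg_sub.
Qed.

Lemma mark_burnside_res_idem (L : closedSubgroup K) : mark L (burnside_res sKH e) = mark L e'.
Proof.
have LK := @csg_sub _ _ L.
pose LH : closedSubgroup H :=
  ClosedSubgroup (csg_subgroup L) (@csg_closed _ _ L) (subset_trans LK sKH).
rewrite mark_burnside_res // (mark_burnside_idem_top pG normal_in_sub).
rewrite -[mark L e]/(mark LH e) (burnside_idemP pG nNH sNK).
congr (_%:R)%R; congr nat_of_bool; apply/idP/asboolP.
  by move=> /set_mem /(NJ_saturation_sub pG nNH sNK (L := LH) LK).
by move=> eL; apply/mem_set/(NJ_saturation_sub pG nNH sNK (L := LH) LK).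
Qed.

Lemma res_burnside_idem (m : M H) :
  mky_res M sKH (burnside_act e m) = burnside_act e' (mky_res M sKH m).
Proof. by rewrite burnside_act_res; apply: burnside_act_eq; exact: mark_burnside_res_idem. Qed.

Lemma res_mky_fixed (m : M H) : mky_fixed M H K (mky_res M sKH m).
Proof.
move=> g eK [Hg _].
by rewrite -(mky_res_conj sKH sKH (conj_set_id Hg) eK) mky_conj_id.
Qed.

(** Write y = e m.  If R y = 0, then [H/K] y = I R y = 0, so y is fixed by
    [not_subconj H K].  The product of this element with e has no nonzero
    mark, hence y = e y = 0. *)
Lemma res_burnside_idem_inj (m : M H) :
  mky_res M sKH (burnside_act e m) = 0%R -> burnside_act e m = 0%R.
Proof.
move=> Ry0; set y := burnside_act e m in Ry0 *.
have fixy : burnside_act (not_subconj H K) y = y.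
  by apply: burnside_act_zero_locus; rewrite (burnside_act_coset sKH) // Ry0 linear0.
rewrite -[y]burnside_act_idem -/y -fixy -burnside_actM.
apply: burnside_act_mark0 => L; have LH := @csg_sub _ _ L.
rewrite markM // (burnside_idemP pG nNH sNK) mark_not_subconj //.
case: (boolP (L \in _)) => [/set_mem|_]; last by rewrite mul0r.
by move=> /(NJ_saturationP pG nNH sNK)[LK _]; rewrite asboolT // mulr0.
Qed.

(** For x in X, conjugation by g carries the stabiliser of x in K to that of g x,
    so it merely permutes the terms of the sum; here X needs to be an H-set
    for g x to make sense. *)
Lemma conj_gset_act_res (X : finGset H) (n : M K) g (eK : K = conj_set g K :> set G) :
  H g -> mky_conj M eK n = n ->
  mky_conj M eK (gset_act n (gset_res sKH X)) = gset_act n (gset_res sKH X).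
Proof.
move=> Hg en; pose XK := gset_res sKH X.
have Kconj k : K (g * k * g^-1) = K k.
  by rewrite [X in X (g * k * g^-1)]eK conj_setE !mulgA mulVg mul1g mulgVK.
have orb (x : X) : #|@gorbit _ _ XK (gs_act g x)| = #|@gorbit _ _ XK x|.
  rewrite -!sum1_card (reindex (gs_act g : X -> X)) /=; last first.
    exact/onW_bij/gs_act_bij.
  apply: eq_bigl => z; apply/gorbitP/gorbitP => -[k Kk ez].
    exists (g^-1 * k * g).
      by rewrite -Kconj !mulgA mulgV mul1g mulgK.
    have Hk := sKH Kk; apply: (gs_act_inj Hg) => /=; rewrite -ez /=.
    have Hk' : H (g^-1 * k * g) by apply: osgM => //; apply: osgM => //; exact: osgV.
    by rewrite -!gs_actM // !mulgA mulgV mul1g.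
  exists (g * k * g^-1); first by rewrite Kconj.
  have Hk := sKH Kk; have Hg' := osgV Hg.
  have Hk' : H (g * k * g^-1) by apply: osgM => //; exact: osgM.
  by rewrite -ez /= -!gs_actM // mulgVK.
rewrite {1}/gset_act linear_sum /= [RHS]/gset_act.
rewrite [RHS](reindex (gs_act g : X -> X)) /=; last exact/onW_bij/gs_act_bij.
apply: eq_bigr => x _; rewrite linearZ /= orb; congr (_ *: _)%R.
have eS : @stab _ _ XK (gs_act g x) = conj_set g (@stab _ _ XK x) :> set G.
  rewrite (stab_gset_res sKH (gs_act g x)) (stab_gset_res sKH x) (stab_act x Hg).
  rewrite [in LHS]eK.
  by apply/seteqP; split=> y; rewrite /setI /= !conj_setE.
rewrite -(mky_ind_conj _ (@stab_sub _ _ XK (gs_act g x)) eK eS).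
by rewrite -(mky_res_conj _ (@stab_sub _ _ XK (gs_act g x)) eK eS) en.
Qed.

(** The action of e' is that of the restriction of e, a combination of H-sets
    restricted to K, to which [conj_gset_act_res] applies. *)
Lemma idem_act_fixed (n : M K) : mky_fixed M H K n ->
  mky_fixed M H K (burnside_act e' n).
Proof.
move=> fixn g eK nKg; have [Hg _] := nKg.
rewrite -(burnside_act_eq n mark_burnside_res_idem) burnside_actE linear_sum.
rewrite !big_map; apply: eq_bigr => t _ /=.
by rewrite linearZ /= conj_gset_act_res // fixn.
Qed.

(** In the double coset formula for K\H/K, a representative x that normalises K
    contributes v, and any other x contributes 0, as the intersection of K
    with a different conjugate of K is a proper subgroup that contains N.  The
    double coset of 1 ensures that the former do occur. *)
Lemma res_ind_fixed (v : M K) : mky_fixed M H K v ->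
  (forall (J : openSubgroup G) (sJK : J `<=` K), N `<=` J -> J <> K ->
    mky_res M sJK v = 0%R) ->
  exists2 w : nat, (0 < w)%N & mky_res M sKH (mky_ind M sKH v) = (w%:R *: v)%R.
Proof.
move=> fixv propv.
have [x0 ex0] := coset_ptP pG K (osg1 H).
have sx0 : stab x0 = K.
  apply: osg_inj; rewrite (stab_coset (osg1 H) ex0) conj_set1.
  by apply/seteqP; split=> g => [[]|Kg] //; split=> //; exact: sKH.
(* Representatives of K\H/K exist since K is the stabiliser of the coset K in
   H/K. *)
have [xs [+ _]] := @sum_double_coset_reps _ _ _ sKH _ (M K) x0 (fun=> 0%R) (fun _ _ _ => erefl).
rewrite sx0 => rxs; rewrite (mky_double_coset sKH sKH rxs).
have [_ xsH xsE] := rxs.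
pose P x := `[< K = conj_set x K :> set G >].
exists (count P xs).
  rewrite -has_count; apply/hasP.
  have [x [[xxs [k [l [Kk Kl e1]]]] _]] := xsE 1 (osg1 H).
  exists x => //; apply/asboolP/conj_set_id.
  have -> : x = k^-1 * l^-1.
    by rewrite -[x](mulKg k) -[k * x](mulgK l) -e1 mul1g.
  by apply: osgM; exact: osgV.
rewrite -sum1_count natr_sum scaler_suml [RHS]big_mkcond /= big_seq [RHS]big_seq.
apply: eq_bigr => x /xsH Hx; rewrite /P; case: asboolP => eK.
  have eC : osg_cap K (osg_conj x K) = K :> set G.
    by rewrite -[RHS]setIid [X in _ = _ `&` X]eK.
  rewrite -(mky_res_conj (@cap_conj_sub G K K x^-1) (@cap_conj_sub G K K x) eK).
  rewrite fixv; last by split.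
  have sKK : K `<=` K by [].
  by rewrite (ind_res_eq _ sKK _ eC) mky_res_id mky_ind_id scale1r.
rewrite propv ?linear0 //.
- move=> g Ng; split; first exact: sNK.
  by move: Ng; rewrite -{1}(nNH.2 _ (osgV Hx)); exact: conj_setS.
- move=> eC; apply: eK.
  have Hx' := osgV Hx.
  have sub : K `<=` conj_set x^-1 K by rewrite -{1}eC => g [].
  by rewrite [in RHS](conj_set_eq_of_sub pG sNK Hx' sub) conj_setVK.
Qed.

End MackeyIdempotents.

Theorem lemma2 (G : topologicalGroupType) (pG : profinite G)
    (M : mackeyFunctor G) (H K N : openSubgroup G)
    (sKH : K `<=` H) (sNK : N `<=` K) (nNH : normal_in H N) :
  set_bij
    [set burnside_act (burnside_idem H N K) m | m in [set: M H]]
    [set burnside_act (burnside_idem K N K) m | m in mky_fixed M H K]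
    (mky_res M sKH).
Proof.
have nNK := normal_in_sub sKH sNK nNH.
split.
- move=> _ [m _ <-]; exists (mky_res M sKH m); first exact: res_mky_fixed.
  by rewrite res_burnside_idem.
- move=> _ _ /set_mem [m1 _ <-] /set_mem [m2 _ <-] eR.
  have eB := linearB (burnside_act (burnside_idem H N K)) m1 m2.
  apply/eqP; rewrite -subr_eq0 -[X in X == _]eB; apply/eqP.
  apply: (res_burnside_idem_inj pG sNK nNH).
  by rewrite eB linearB /= eR subrr.
- move=> _ [n fixn <-]; set v := burnside_act _ n.
  have fixv : mky_fixed M H K v by exact: idem_act_fixed.
  have propv (J : openSubgroup G) (sJK : J `<=` K) :
    N `<=` J -> J <> K -> mky_res M sJK v = 0%R by exact: (res_idem_proper pG nNK).
  have [w w0 RI] := res_ind_fixed pG sKH sNK nNH fixv propv.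
  set m := (w%:R^-1 *: mky_ind M sKH v)%R.
  exists (burnside_act (burnside_idem H N K) m); first by exists m.
  rewrite res_burnside_idem // /m linearZ /= RI scalerA mulVf ?scale1r.
    exact: burnside_act_idem.
  by rewrite Num.Theory.pnatr_eq0 -lt0n.
Qed.
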